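(* Let $a_k=k^{\alpha}$ and $\sigma_k=\exp(\beta k)$, $k\in\mathbb N$, with $\alpha>0,\beta>0$; let $\kappa=(\alpha,\beta,q)$ and let $\Sigma$ be a compact subset of $(0,\infty)^2\times(0,2]$. All limits are as $\varepsilon\to0$. (a) (Lower bounds.) Suppose that the set of pairs $(\alpha,\beta)$ occurring in $\Sigma$ contains an interval $\{(\alpha,\beta):\beta\in[1/(2b),1/(2a)]\}$ for some $0<a<b<\infty$ and some fixed $\alpha>0$. Then there exists a constant $d>0$ such that if $$\limsup_{\varepsilon\to0}\ \sup_{\kappa\in\Sigma}\frac{u_\varepsilon(\kappa)}{\log\log(\varepsilon^{-1})}\le d,$$ then $\gamma_\varepsilon(\Theta_\varepsilon(\Sigma))\to1$. (b) (Upper bounds.) Let $C>2$, let $L=L_\varepsilon$ be integer-valued with $L_\varepsilon\to\infty$, $L_\varepsilon=o(\log\log(\varepsilon^{-1}))$, and let $$H_k=\begin{cases}\sqrt{2\log L},&k<L,\\ \sqrt{C\log k},&k\ge L,\end{cases}\qquad \psi_\varepsilon=\mathbf 1\{\exists\,k\in\mathbb N:\ |y_k|>\varepsilon H_k\}.$$ Then $\alpha_\varepsilon(\psi_\varepsilon)=o(1)$, and there exists a constant $D=D(\Sigma)>0$ such that if $$\liminf_{\varepsilon\to0}\ \inf_{\kappa\in\Sigma}\frac{u_\varepsilon(\kappa)}{\log\log(\varepsilon^{-1})}>D,$$ then $\beta_\varepsilon(\Theta_\varepsilon(\Sigma),\psi_\varepsilon)=o(1)$. (c) (Adaptive separation rates.)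 For $\Sigma$ as in (a), the adaptive separation rates $r^{\mathrm{ad}}_\varepsilon(\kappa)$, $\kappa\in\Sigma$ (corresponding to $u^{\mathrm{ad}}_\varepsilon=\log\log(\varepsilon^{-1})$), are given by $$r^{\mathrm{ad}}_\varepsilon(\kappa)=\left(\frac{2\beta}{2\log(\varepsilon^{-1})-2\alpha\log\log(\varepsilon^{-1})-\log\log\log(\varepsilon^{-1})}\right)^{\alpha}\sim\left(\frac{\beta}{\log(\varepsilon^{-1})}\right)^{\alpha}.$$
   Context: Model: one observes $y=\{y_k\}_{k\in\mathbb N}$, $y_k=\eta_k+\varepsilon\xi_k$, with $\xi_k$ i.i.d. $N(0,1)$, $\varepsilon>0$ small, $\eta\in\ell^2$ unknown; $E_{\varepsilon,\eta}$ is the corresponding expectation. A test $\psi$ is a measurable function of $y$ with values in $[0,1]$; $\alpha_\varepsilon(\psi)=E_{\varepsilon,0}\psi$, $\beta_\varepsilon(\Theta,\psi)=\sup_{\eta\in\Theta}E_{\varepsilon,\eta}(1-\psi)$, $\gamma_\varepsilon(\Theta)=\inf_\psi\big(\alpha_\varepsilon(\psi)+\beta_\varepsilon(\Theta,\psi)\big)$. Adaptive setting: a family of radii $r_\varepsilon(\kappa)>0$, $\kappa\in\Sigma$, with $r_\varepsilon(\kappa)\to0$ as $\varepsilon\to0$, is given. For $\kappa\in\Sigma$ and $r>0$, $$\Theta_\varepsilon(\kappa,r)=\Big\{\eta\in\ell^2:\sum_k|a_k\sigma_k\eta_k|^q\le1,\ \sum_k\sigma_k^2\eta_k^2\ge r^2\Big\}$$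 with $a_k=a_k(\kappa)$, $\sigma_k=\sigma_k(\kappa)$, $q=q(\kappa)$, and $\Theta_\varepsilon(\Sigma)=\bigcup_{\kappa\in\Sigma}\Theta_\varepsilon(\kappa,r_\varepsilon(\kappa))$. One tests $H_0:\eta=0$ against $H_1:\eta\in\Theta_\varepsilon(\Sigma)$. Define $u_\varepsilon(\kappa,r)$ by $u_\varepsilon^2(\kappa,r)=\frac{1}{2\varepsilon^4}\inf_{\eta\in\Theta_\varepsilon(\kappa,r)}\sum_k\eta_k^4$, and $u_\varepsilon(\kappa)=u_\varepsilon(\kappa,r_\varepsilon(\kappa))$. A family $u^{\mathrm{ad}}_\varepsilon\to\infty$ characterizes adaptive distinguishability if there are constants $0<d\le D<\infty$ (depending on $\Sigma$) such that $\gamma_\varepsilon(\Theta_\varepsilon(\Sigma))\to1$ when $\limsup_{\varepsilon\to0}\sup_{\kappa\in\Sigma}u_\varepsilon(\kappa)/u^{\mathrm{ad}}_\varepsilon<d$, and $\gamma_\varepsilon(\Theta_\varepsilon(\Sigma))\to0$ when $\liminf_{\varepsilon\to0}\inf_{\kappa\in\Sigma}u_\varepsilon(\kappa)/u^{\mathrm{ad}}_\varepsilon>D$. A family $r^{\mathrm{ad}}_\varepsilon(\kappa)$, $\kappa\in\Sigma$, with $u^{\mathrm{ad}}_\varepsilon\asymp u_\varepsilon(\kappa,r^{\mathrm{ad}}_\varepsilon(\kappa))$ is called the family of adaptive separation rates. ($\asymp$: ratio bounded above and away from $0$ for small $\varepsilon$; $\sim$: ratio tends to $1$.) *)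

(* Defs.v *)
From HB Require Import structures.
From mathcomp Require Export all_boot all_order all_algebra.
From mathcomp Require Export all_classical all_reals all_analysis.

Set Implicit Arguments.
Unset Strict Implicit.
Unset Printing Implicit Defensive.

Import Order.TTheory GRing.Theory Num.Theory.
Export numFieldNormedType.Exports.

Local Open Scope classical_set_scope.
Local Open Scope ring_scope.

(* All sequences indexed by the positive integers are represented by functions
   on nat: the argument k stands for the index k + 1. *)

Section Model.
Context {R : realType}.

(* The product sigma-algebra on sequences, generated by the coordinates. *)
Definition cylinders : set_system (nat -> R) :=
  [set A | exists k : nat, exists2 B : set R,
     measurable B & A = [set y | B (y k)]].

Definition is_test (psi : (nat -> R) -> R) : Prop :=
  measurable_fun [set: g_sigma_algebraType cylinders] psi /\
  forall y, 0 <= psi y <= 1.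

Context {d : measure_display} {Omega : measurableType d}
        {P : probability Omega R}.

Definition mutually_independent (xi : nat -> {RV P >-> R}) : Prop :=
  forall (s : seq nat) (B : nat -> set R), uniq s ->
    (forall k, measurable (B k)) ->
    P [set w | forall k, k \in s -> B k (xi k w)] =
    (\prod_(k <- s) P (xi k @^-1` B k))%E.

Definition iid_std_normal (xi : nat -> {RV P >-> R}) : Prop :=
  (forall (k : nat) (A : set R), measurable A ->
     distribution P (xi k) A = normal_prob 0 1 A) /\
  mutually_independent xi.

Variable xi : nat -> {RV P >-> R}.

Definition observation (e : R) (eta : nat -> R) (w : Omega) : nat -> R :=
  fun k => eta k + e * xi k w.

Definition Exp (e : R) (eta : nat -> R) (f : (nat -> R) -> R) : R :=
  fine ('E_P [fun w => f (observation e eta w)]).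

Definition alpha_err (e : R) (psi : (nat -> R) -> R) : R :=
  Exp e (fun=> 0) psi.

(* The real-valued [sup] is 0 on the empty set, so an empty alternative has
   type II error 0. *)
Definition beta_err (e : R) (T : set (nat -> R)) (psi : (nat -> R) -> R) : R :=
  sup [set Exp e eta (fun y => 1 - psi y) | eta in T].

Definition gamma_err (e : R) (T : set (nat -> R)) : R :=
  inf [set alpha_err e psi + beta_err e T psi | psi in is_test].

End Model.

Section Alternatives.
Context {R : realType}.

Definition ell2 (eta : nat -> R) : Prop :=
  (\sum_(0 <= k <oo) ((eta k) ^+ 2)%:E < +oo)%E.

Definition ellipsoid_ball_compl (a s : nat -> R) (q r : R) : set (nat -> R) :=
  [set eta | [/\ ell2 eta,
     (\sum_(0 <= k <oo) (`|a k * s k * eta k| `^ q)%:E <= 1)%E &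
     ((r ^+ 2)%:E <= \sum_(0 <= k <oo) ((s k) ^+ 2 * (eta k) ^+ 2)%:E)%E]].

(* kappa = (alpha, beta, q) *)
Definition alpha_of (kappa : R * R * R) : R := kappa.1.1.
Definition beta_of (kappa : R * R * R) : R := kappa.1.2.
Definition q_of (kappa : R * R * R) : R := kappa.2.

Definition a_seq (kappa : R * R * R) (k : nat) : R :=
  k.+1%:R `^ alpha_of kappa.
Definition sigma_seq (kappa : R * R * R) (k : nat) : R :=
  expR (beta_of kappa * k.+1%:R).

Definition Theta (kappa : R * R * R) (r : R) : set (nat -> R) :=
  ellipsoid_ball_compl (a_seq kappa) (sigma_seq kappa) (q_of kappa) r.

Definition Theta_union (Sigma : set (R * R * R)) (r : R * R * R -> R) :
    set (nat -> R) :=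
  \bigcup_(kappa in Sigma) Theta kappa (r kappa).

(* The value is +oo when [Theta kappa r] is empty. *)
Definition u_ext (e : R) (kappa : R * R * R) (r : R) : \bar R :=
  sqrte ((2 * e ^+ 4)^-1%:E *
    ereal_inf [set (\sum_(0 <= k <oo) ((eta k) ^+ 4)%:E)%E
              | eta in Theta kappa r])%E.

Definition radii (Sigma : set (R * R * R)) (r : R -> R * R * R -> R) : Prop :=
  (forall e kappa, 0 < e -> Sigma kappa -> 0 < r e kappa) /\
  (forall kappa, Sigma kappa -> r e kappa @[e --> 0^'+] --> (0 : R)).

Definition limsup_ratio (Sigma : set (R * R * R)) (r : R -> R * R * R -> R)
    (v : R -> R) : \bar R :=
  limf_esup (fun e => ereal_sup
    [set (u_ext e kappa (r e kappa) / (v e)%:E)%E | kappa in Sigma]) 0^'+.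

Definition liminf_ratio (Sigma : set (R * R * R)) (r : R -> R * R * R -> R)
    (v : R -> R) : \bar R :=
  limf_einf (fun e => ereal_inf
    [set (u_ext e kappa (r e kappa) / (v e)%:E)%E | kappa in Sigma]) 0^'+.

Definition log_inv (e : R) : R := ln e^-1.
Definition loglog_inv (e : R) : R := ln (log_inv e).
Definition logloglog_inv (e : R) : R := ln (loglog_inv e).

Definition contains_beta_interval (Sigma : set (R * R * R)) : Prop :=
  exists a b alpha : R, [/\ 0 < a, a < b, 0 < alpha &
    forall beta, (2 * b)^-1 <= beta <= (2 * a)^-1 ->
      exists q, Sigma (alpha, beta, q)].

Definition threshold (C : R) (L : int) (k : nat) : R :=
  if (k.+1%:Z < L)%R then Num.sqrt (2 * ln L%:~R)
  else Num.sqrt (C * ln k.+1%:R).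

Definition threshold_test (C : R) (L : int) (e : R) : (nat -> R) -> R :=
  \1_[set y | exists k : nat, e * threshold C L k < `|y k|].

Definition admissible_cutoff (L : R -> int) : Prop :=
  ((L e)%:~R : R) @[e --> 0^'+] --> +oo /\
  ((L e)%:~R / loglog_inv e) @[e --> 0^'+] --> (0 : R).

Definition r_ad (e : R) (kappa : R * R * R) : R :=
  (2 * beta_of kappa /
    (2 * log_inv e - 2 * alpha_of kappa * loglog_inv e - logloglog_inv e))
  `^ alpha_of kappa.

(* The relations between families indexed by Sigma are uniform over Sigma. *)
Definition asymp_on (Sigma : set (R * R * R)) (v : R -> R)
    (u : R -> R * R * R -> \bar R) : Prop :=
  exists c C : R, [/\ 0 < c, 0 < C &
    \forall e \near 0^'+, forall kappa, Sigma kappa ->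
      ((c * v e)%:E <= u e kappa <= (C * v e)%:E)%E].

Definition equiv_on (Sigma : set (R * R * R)) (r s : R -> R * R * R -> R) :
    Prop :=
  forall delta : R, 0 < delta ->
    \forall e \near 0^'+, forall kappa, Sigma kappa ->
      `|r e kappa / s e kappa - 1| < delta.

End Alternatives.

Section Adaptive.
Context {R : realType} {d : measure_display} {Omega : measurableType d}
        {P : probability Omega R}.
Variables (xi : nat -> {RV P >-> R}) (Sigma : set (R * R * R)).

Definition characterizes_adaptive_distinguishability (uad : R -> R) : Prop :=
  uad e @[e --> 0^'+] --> +oo /\
  exists d0 D0 : R, [/\ 0 < d0, d0 <= D0 &
    forall r : R -> R * R * R -> R, radii Sigma r ->
      ((limsup_ratio Sigma r uad < d0%:E)%E ->
        gamma_err xi e (Theta_union Sigma (r e)) @[e --> 0^'+] --> (1 : R)) /\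
      ((D0%:E < liminf_ratio Sigma r uad)%E ->
        gamma_err xi e (Theta_union Sigma (r e)) @[e --> 0^'+] --> (0 : R))].

Definition adaptive_separation_rates (uad : R -> R)
    (rad : R -> R * R * R -> R) : Prop :=
  characterizes_adaptive_distinguishability uad /\
  asymp_on Sigma uad (fun e kappa => u_ext e kappa (rad e kappa)).

End Adaptive.

(* Main.v *)
(* Only the mass of one coordinate matters. If [1 <= a_m r] then the constraint
   [sum (a_k sigma_k eta_k)^2 <= 1] (implied by the one with exponent [q <= 2])
   and [sum (sigma_k eta_k)^2 >= r^2] force the energy onto the first [m]
   coordinates up to a polynomial weight; as sigma_k grows exponentially, some
   [k <= m] has [eta_k^2 >= r^2 / (K sigma_m^2)] with [K] uniform over the
   compact [Sigma]. Conversely [r / sigma_m] at [m] alone is admissible as soon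
   as [a_m r <= 1]. Hence, up to constants, u is the least possible value of
   [max_k eta_k^2 / e^2] over the alternative.

   Upper bound: with [l = loglog (1/e)], [u >= D l] yields a coordinate
   [|eta_k| >= e sqrt (D' l)] with [k] polynomial in [log (1/e)], which exceeds
   the threshold [e H_k] by [e sqrt l].

   Lower bound: if [u <= d l] for every kappa then, varying beta, the
   alternative contains the spikes of height [e B], [B^2 = l / 2], at about
   [log (1/e)] different positions. For the uniform prior on these spikes the
   second moment of the likelihood ratio is at most
   [1 + exp (B^2) / n = 1 + O (log (1/e) ^ (- 1/2))]. *)

From HB Require Import structures.
Require Import Defs.
From mathcomp Require Import measurable_realfun.
From mathcomp Require Import ring lra zify.
Set Implicit Arguments.
Unset Strict Implicit.
Unset Printing Implicit Defensive.
Import Order.TTheory GRing.Theory Num.Theory.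
Local Open Scope classical_set_scope.
Local Open Scope ring_scope.

(** * Densities and the normal law *)

(** The hypotheses control only [u], while the radii are arbitrary functions of [e] and [kappa].
    [ellipsoid_head] is the bridge: coordinates that are all small up to an index [m] with
    [1 <= a_m r] force [r] itself to be small. The index where [a_k r = 1] is in general not an
    integer; rounding it costs a factor [sigma_(m+1)^2 / sigma_m^2 = exp (2 beta)], bounded over
    [Sigma]. Why varying beta produces many spikes: a spike of height [e B] at the 1-based index [k]
    lies on the boundary of the ellipsoid when [beta k + alpha ln k + ln B = log (1/e)]. So [k] is
    about [log (1/e) / beta], and an interval of values of beta hits every integer of an interval of
    length proportional to [log (1/e) = exp l]. Since the number of spikes is of order [exp l], any
    [B^2 = c l] with [c < 1] would serve; [c = 1/2] is a convenient choice. The law of the sequence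
    [xi] is known only through finite products, so the Gaussian shift is proved by uniqueness of
    measures on boxes with finitely many constrained sides. *)

Section density.
Context d (T : measurableType d) (R : realType).
Variable mu : {measure set T -> \bar R}.
Local Open Scope ereal_scope.

Definition density (g : T -> R) (mg : measurable_fun [set: T] g)
  (g0 : forall x, (0 <= g x)%R) := fun A : set T => \int[mu]_(x in A) (g x)%:E.

Section density_measure.
Variables (g : T -> R) (mg : measurable_fun [set: T] g)
  (g0 : forall x, (0 <= g x)%R).

Let density0 : density mg g0 set0 = 0.
Proof. by rewrite /density integral_set0. Qed.

Let density_ge0 A : 0 <= density mg g0 A.
Proof. by apply: integral_ge0 => x _; rewrite lee_fin. Qed.

Let density_sigma_additive : semi_sigma_additive (density mg g0).
Proof.
apply: semi_sigma_additive_nng_induced; first exact/measurable_EFinP.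
by move=> x; rewrite lee_fin.
Qed.

HB.instance Definition _ := isMeasure.Build _ _ _ (density mg g0)
  density0 density_ge0 density_sigma_additive.

End density_measure.

Import HBNNSimple.

(** Simple functions, then monotone convergence. [nu] is any measure having density [g], not
    literally [density mg g0], so that the lemma applies to normal laws, restrictions and
    push-forwards alike. *)
Lemma ge0_integral_density (nu : {measure set T -> \bar R}) (g : T -> R)
    (f : T -> \bar R) :
  measurable_fun [set: T] g -> (forall x, 0 <= g x)%R ->
  (forall A, measurable A -> nu A = \int[mu]_(x in A) (g x)%:E) ->
  measurable_fun [set: T] f -> (forall x, 0 <= f x) ->
  \int[nu]_x f x = \int[mu]_x (f x * (g x)%:E).
Proof.
move=> mg g0 nug mf f0; pose f_ := nnsfun_approx measurableT mf.
have mEg : measurable_fun [set: T] (EFin \o g) by exact/measurable_EFinP.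
have mf_ n : measurable_fun [set: T] (EFin \o f_ n).
  exact/measurable_EFinP/measurable_funTS.
have step n : \int[nu]_x (f_ n x)%:E = \int[mu]_x ((f_ n x)%:E * (g x)%:E).
  under eq_integral do rewrite fimfunE -fsumEFin//.
  rewrite [LHS]ge0_integral_fsum//; last 2 first.
  - by move=> r; exact/measurable_EFinP/measurableT_comp.
  - by move=> m x _; rewrite EFinM nnfun_muleindic_ge0.
  under [RHS]eq_integral.
    move=> x xD; rewrite fimfunE -fsumEFin// ge0_mule_fsuml; last first.
      by move=> r; rewrite EFinM nnfun_muleindic_ge0.
    over.
  rewrite [RHS]ge0_integral_fsum//; last 2 first.
  - move=> r; apply: emeasurable_funM => //.
    by apply/measurable_EFinP; apply/measurableT_comp => //.
  - move=> m x _; apply: mule_ge0; last by rewrite lee_fin.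
    by rewrite EFinM nnfun_muleindic_ge0.
  apply: eq_fsbigr => r _.
  rewrite integralZl_indic_nnsfun// integral_indic//= setIT nug//.
  have [rn|rn] := leP 0%R r; last first.
    rewrite preimage_nnfun0// integral_set0 mule0.
    by rewrite integral0_eq// => x _; rewrite indic0 mulr0 mul0e.
  under [RHS]eq_integral do rewrite EFinM -muleA.
  rewrite ge0_integralZl//; last 2 first.
  - by apply: emeasurable_funM => //; exact/measurable_EFinP/measurable_indic.
  - by move=> x _; rewrite mule_ge0// lee_fin.
  rewrite [in LHS]integral_mkcond; congr (_ * _).
  by apply: eq_integral => x _; rewrite epatch_indic muleC.
transitivity (limn (fun n => \int[nu]_x (f_ n x)%:E)).
  rewrite -monotone_convergence//=.
  - apply: eq_integral => x _; apply/esym/cvg_lim => //=.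
    exact: cvg_nnsfun_approx.
  - by move=> n x _; rewrite lee_fin.
  - by move=> x _ a b ab; rewrite lee_fin//; exact/lefP/nd_nnsfun_approx.
rewrite (_ : \int[mu]_x _ =
    limn (fun n => \int[mu]_x ((f_ n x)%:E * (g x)%:E))); last first.
  rewrite -monotone_convergence//=.
  - apply: eq_integral => x _; apply/esym/cvg_lim => //.
    apply: cvgeZr => //; exact: cvg_nnsfun_approx.
  - move=> n; apply: (@emeasurable_funM _ _ _ _ (EFin \o f_ n) (EFin \o g)) =>
    //.
  - by move=> n x _; rewrite mule_ge0// lee_fin.
  - move=> x _ a b ab; rewrite lee_pmul// ?lee_fin//.
    exact/lefP/nd_nnsfun_approx.
by congr (limn _); apply/funext => n /=; rewrite step.
Qed.

End density.

Section normal_shift.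
Context {R : realType}.
Local Open Scope ereal_scope.
Local Notation mu := lebesgue_measure.

(** Two finite measures that agree on the closed right half-lines, a generating family stable under
    intersection, are equal; on half-lines the equality is the substitution [x + c]. *)
Lemma normal_prob_shift (c : R) (A : set R) : measurable A ->
  normal_prob 0 1 [set x | A (x + c)%R] = normal_prob c 1 A.
Proof.
move=> mA.
have mc : measurable_fun [set: measurableTypeR R]
    ((fun x => x + c)%R : measurableTypeR R -> measurableTypeR R).
  exact: (@measurable_funD _ (measurableTypeR R)).
pose X : {mfun measurableTypeR R >-> measurableTypeR R} :=
  HB.pack (fun x : R => x + c)%R (isMeasurableFun.Build _ _ _ _ _ mc).
rewrite -[LHS]/(distribution (normal_prob 0 1) X A).
apply: (@measure_unique _ R (measurableTypeR R) (@RGenCInfty.G R)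
  (fun k => `[- k%:R, +oo[%classic)%R _ _ _ _ (distribution (normal_prob 0 1) X)
  (normal_prob c 1)); last exact: mA.
- exact: RGenCInfty.measurableE.
- move=> _ _ [x ->] [y ->]; exists (Num.max x y).
  by apply/seteqP; split => z /=; rewrite !in_itv/= !andbT ge_max => /andP.
- by move=> k; exists (- k%:R)%R.
- apply/seteqP; split => // x _; exists (Num.truncn `|x|).+1 => //=.
  rewrite in_itv/= andbT lerNl (le_trans _ (ltW (truncnS_gt _)))//.
  by rewrite -normrN ler_norm.
- move=> _ [y ->]; rewrite /distribution /pushforward /= /normal_prob.
  have dF : (fun x : R => x + c)%R^`()%classic = cst 1%R.
    by apply/funext => x; rewrite derive1E derive_val addr0.
  have := @increasing_ge0_integration_by_substitutiony R (fun x => x + c)%R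
    (normal_pdf c 1) (y - c)%R.
  rewrite [in X in X -> _]/= subrK => ->.
  - rewrite (_ : _ @^-1` _ = `[(y - c)%R, +oo[%classic); last first.
      by apply/seteqP; split => x /=; rewrite !in_itv/= !andbT lerBlDr.
    apply: eq_integral => x _; rewrite dF/= !fctE/= mulr1 !normal_pdfE
      ?oner_neq0//.
    by rewrite /normal_fun subr0 addrK.
  - by move=> a b _ _; rewrite ltrD2r.
  - by move=> x _; rewrite dF; exact: cvg_cst.
  - by rewrite dF; exact: is_cvg_cst.
  - by rewrite dF; exact: is_cvg_cst.
  - split; first by move=> x _; exact: derivableD.
    apply: cvg_at_right_filter; apply: cvgD; [exact: cvg_id|exact: cvg_cst].
  - exact: cvg_addrr.
  - by apply: continuous_subspaceT; exact: continuous_normal_pdf.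
  - by move=> x _; exact: normal_pdf_ge0.
- by move=> k; rewrite -ge0_fin_numE// fin_num_measure.
Qed.

(** One-dimensional Cameron-Martin formula: the exponential is the ratio of the densities of
    [N(c, 1)] and [N(0, 1)]. *)
Lemma normal_prob_shiftE (c : R) (A : set R) : measurable A ->
  normal_prob 0 1 [set x | A (x + c)%R] =
  \int[normal_prob 0 1]_(x in A) (expR (c * x - c ^+ 2 / 2))%:E.
Proof.
move=> mA; rewrite normal_prob_shift//.
have me : measurable_fun [set: R] (fun x => expR (c * x - c ^+ 2 / 2))%R.
  by apply: measurableT_comp => //; apply: measurable_funB => //.
rewrite integral_mkcond (@ge0_integral_density _ _ _ mu _ (normal_pdf 0 1)) //.
- rewrite /normal_prob [LHS]integral_mkcond; apply: eq_integral => x _.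
  rewrite !epatch_indic muleAC -[X in _ = X * _]EFinM; congr (_%:E * _)%E.
  rewrite !normal_pdfE ?oner_neq0// /normal_fun mulrCA; congr (_ * _)%R.
  rewrite -expRD; congr expR; rewrite expr1n subr0; by field.
- exact: measurable_normal_pdf.
- exact: normal_pdf_ge0.
- apply/(measurable_restrictT _ _).1 => //; apply/measurable_EFinP.
  exact: measurable_funTS.
- by move=> x; rewrite epatch_indic mule_ge0// lee_fin ?expR_ge0.
Qed.

(* Mills' bound: replace the density [phi x] by [x / t * phi x] on [x >= t]. *)
Lemma normal_prob_tail (t : R) : (0 < t)%R ->
  normal_prob 0 1 `[t, +oo[%classic <= (expR (- t ^+ 2 / 2) / t)%:E.
Proof.
move=> t0; pose F (x : R) := (- expR (- x ^+ 2 / 2))%R.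
pose f (x : R) := (x * expR (- x ^+ 2 / 2))%R.
have dF (x : R) : is_derive x 1%R F (f x).
  rewrite /F /f; apply: is_derive_eq.
  by rewrite /GRing.scale/=; field.
have cF : continuous F.
  by move=> x; apply/differentiable_continuous/derivable1_diffP.
have cf : continuous f.
  rewrite (_ : f = (fun x => x * - F x)%R); last first.
    by apply/funext => z; rewrite opprK.
  by move=> x; apply: cvgM; [exact: cvg_id|apply: cvgN; exact: cF].
have -> : (expR (- t ^+ 2 / 2) / t)%:E =
    (t^-1)%:E * \int[mu]_(x in `[t, +oo[) (f x)%:E.
  rewrite (@ge0_continuous_FTC2y _ f F t 0%R).
  - by rewrite /F EFinN oppeK add0e -EFinM mulrC.
  - by move=> x tx; rewrite mulr_ge0 ?expR_ge0// (le_trans (ltW t0)).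
  - exact: continuous_subspaceT.
  - rewrite -oppr0; apply: cvgN.
    rewrite (_ : (fun x => _) =
        (fun z => expR (- z)) \o (fun x => x ^+ 2 / 2))%R; last first.
      by apply/funext => z /=; rewrite mulNr.
    apply: (@cvg_comp _ _ _ _ _ _ (pinfty_nbhs R)); last exact: cvgr_expR.
    by apply: gt0_cvgMly; rewrite ?invr_gt0//; exact: cvgr_expr2.
  - by move=> x _.
  - exact/cvg_at_right_filter/cF.
  - by move=> x _; rewrite derive1E derive_val.
have mf (D : set R) : measurable_fun D f.
  by apply: measurable_funTS; exact: continuous_measurable_fun.
rewrite -ge0_integralZl//; last 3 first.
- apply/measurable_EFinP; exact: mf.
- move=> x /=; rewrite in_itv/= andbT => tx; rewrite lee_fin mulr_ge0
  ?expR_ge0//.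
  by rewrite (le_trans (ltW t0)).
- by rewrite lee_fin invr_ge0 ltW.
rewrite /normal_prob; apply: ge0_le_integral => //=.
- by move=> x _; rewrite lee_fin normal_pdf_ge0.
- apply/measurable_EFinP; apply: measurable_funTS; exact: measurable_normal_pdf.
- apply: emeasurable_funM => //; apply/measurable_EFinP; exact: mf.
- move=> x; rewrite in_itv/= andbT => tx; rewrite lee_fin normal_pdfE
  ?oner_neq0//.
  have -> : normal_fun 0 1 x = expR (- x ^+ 2 / 2).
    by rewrite /normal_fun subr0 expr1n.
  rewrite mulrA ler_wpM2r ?expR_ge0// (@le_trans _ _ 1%R)//.
    have pi1 : (1 <= 1 ^+ 2 * pi *+ 2 :> R)%R.
      by rewrite expr1n mul1r mulr2n; have := pi_ge2 R; lra.
    rewrite invf_le1 ?sqrtr_gt0 ?(lt_le_trans _ pi1)//.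
    by rewrite -[leLHS]sqrtr1 ler_wsqrtr.
  by rewrite mulrC ler_pdivlMr// mul1r.
Qed.

End normal_shift.

(** * Gaussian shifts on the sequence space *)

Section sequence_space.
Context {R : realType}.
Local Notation seqR := (g_sigma_algebraType (@cylinders R)).

Lemma measurable_coordinate (k : nat) (B : set R) : measurable B ->
  measurable ([set y | B (y k)] : set seqR).
Proof. by move=> mB; apply: sub_sigma_algebra; exists k; exists B. Qed.

Lemma measurable_fun_coordinate (k : nat) :
  measurable_fun [set: seqR] (fun y : seqR => y k).
Proof. by move=> _ B mB; rewrite setTI; exact: measurable_coordinate. Qed.

Lemma measurable_fun_seq d (T : measurableType d) (f : T -> seqR) :
  (forall k, measurable_fun [set: T] (fun x => f x k)) ->
  measurable_fun [set: T] f.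
Proof.
move=> mf; apply: (@measurability _ _ T seqR setT f (@cylinders R)) => //.
by move=> _ [_ [k [B mB ->]] <-]; exact: mf.
Qed.

Definition box (B : nat -> set R) : set seqR := [set y | forall k, B k (y k)].

(* Only finitely many sides are constrained, so that independence applies. *)
Definition boxes : set_system seqR :=
  [set A | exists n (B : nat -> set R), [/\ forall k, measurable (B k),
     forall k, (n <= k)%N -> B k = setT & A = box B]].

Lemma measurable_box (B : nat -> set R) : (forall k, measurable (B k)) ->
  measurable (box B).
Proof.
move=> mB; rewrite (_ : box B = \bigcap_k [set y | B k (y k)]).
  by apply: bigcapT_measurable => k; exact: measurable_coordinate.
by apply/seteqP; split => [y yB k _|y yB k]; [exact: yB|exact: (yB k)].
Qed.

Lemma boxes_setI : setI_closed boxes.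
Proof.
move=> _ _ [n [B [mB BT ->]]] [m [C [mC CT ->]]].
exists (maxn n m), (fun k => B k `&` C k); split.
- by move=> k; exact: measurableI.
- by move=> k; rewrite geq_max => /andP[/BT -> /CT ->]; rewrite setTI.
- apply/seteqP; split => [y [yB yC] k|y yBC].
    by split; [exact: yB|exact: yC].
  by split => k; have [] := yBC k.
Qed.

Lemma measurable_boxes : @measurable _ seqR = <<s boxes >>.
Proof.
apply/seteqP; split.
- apply: smallest_sub; first exact: smallest_sigma_algebra.
  move=> _ [k [B mB ->]]; apply: sub_sigma_algebra.
  exists k.+1, (fun j => if j == k then B else setT); split.
  + by move=> j; case: ifP.
  + by move=> j kj; rewrite gtn_eqF.
  + apply/seteqP; split => y /=; last by move=> /(_ k); rewrite eqxx.
    by move=> yB j; case: ifPn => // /eqP ->.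
- apply: smallest_sub; first exact: sigma_algebra_measurable.
  by move=> _ [n [B [mB _ ->]]]; exact: measurable_box.
Qed.

End sequence_space.

Section gaussian_shift.
Context {R : realType} {d : measure_display} {Omega : measurableType d}
  {P : probability Omega R}.
Variables (xi : nat -> {RV P >-> R}) (hxi : iid_std_normal xi).
Local Notation seqR := (g_sigma_algebraType (@cylinders R)).
Local Open Scope ereal_scope.

Lemma iid_box (B : nat -> set R) (n : nat) : (forall k, measurable (B k)) ->
  (forall k, (n <= k)%N -> B k = setT) ->
  P [set w | forall k, B k (xi k w)] =
  \prod_(k <- iota 0 n) normal_prob 0 1 (B k).
Proof.
move=> mB BT; rewrite (_ : [set _ | _] =
    [set w | forall k, k \in iota 0 n -> B k (xi k w)]).
  have [xiN xiI] := hxi; rewrite xiI ?iota_uniq//.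
  by apply: eq_bigr => k _; rewrite -(xiN k).
apply/seteqP; split => [w wB k _|w wB k]; first exact: wB.
have [nk|kn] := leqP n k; first by rewrite BT.
by apply: wB; rewrite mem_iota.
Qed.

(** Coordinate [m] is independent of the event on all the others. The product formula [key], taken
    at [setT], identifies the product over [k != m] with the probability of that event. *)
Lemma iid_split (B : nat -> set R) (n m : nat) (C : set R) :
  (forall k, measurable (B k)) -> (forall k, (n <= k)%N -> B k = setT) ->
  measurable C ->
  P (xi m @^-1` C `&` [set w | forall k, k != m -> B k (xi k w)]) =
  normal_prob 0 1 C * P [set w | forall k, k != m -> B k (xi k w)].
Proof.
move=> mB BT mC.
pose D E k := if k == m then E else B k.
have mD E k : measurable E -> measurable (D E k) by rewrite /D; case: ifP.
have DT E k : (maxn n m.+1 <= k)%N -> D E k = setT.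
  by rewrite geq_max /D => /andP[nk mk]; rewrite gtn_eqF// BT.
have key E : measurable E ->
    P (xi m @^-1` E `&` [set w | forall k, k != m -> B k (xi k w)]) =
    normal_prob 0 1 E *
    \prod_(k <- iota 0 (maxn n m.+1) | k != m) normal_prob 0 1 (B k).
  move=> mE; rewrite (_ : _ `&` _ = [set w | forall k, D E k (xi k w)]).
    rewrite (@iid_box (D E) (maxn n m.+1)) => [|k|k]; [|exact: mD|exact: DT].
    rewrite (bigD1_seq m) ?iota_uniq ?mem_iota ?add0n ?leq_max ?ltnSn ?orbT//=.
    rewrite /D eqxx; congr (_ * _).
    by apply: eq_bigr => k /negbTE ->.
  apply/seteqP; split => w /=.
    by move=> [wE wB] k; rewrite /D; case: eqVneq => [->//|/wB].
  move=> wD; split; first by have := wD m; rewrite /D eqxx.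
  by move=> k km; have := wD k; rewrite /D (negbTE km).
rewrite key//; have := key setT measurableT.
by rewrite preimage_setT setTI probability_setT mul1e => ->.
Qed.

(** Cameron-Martin for a shift of one coordinate. Both sides integrate [f] over sequence space:
    against the law of the shifted sequence under [P], and against the law of the unshifted one
    under the reweighted measure [Q]. These laws agree on boxes, hence everywhere. *)
Lemma gaussian_change_of_measure (c : R) (m : nat) (f : seqR -> \bar R) :
  measurable_fun [set: seqR] f -> (forall y, 0 <= f y) ->
  \int[P]_w f (fun k => xi k w + c *+ (k == m))%R =
  \int[P]_w (f (fun k => xi k w) *
             (expR (c * xi m w - c ^+ 2 / 2))%:E).
Proof.
move=> mf f0.
pose X0 (w : Omega) : seqR := fun k => xi k w.
pose X1 (w : Omega) : seqR := fun k => (xi k w + c *+ (k == m))%R.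
have mX0 : measurable_fun [set: Omega] X0 by exact: measurable_fun_seq.
have mX1 : measurable_fun [set: Omega] X1.
  by apply: measurable_fun_seq => k; exact: measurable_funD.
pose pX0 : {mfun Omega >-> seqR} := HB.pack X0 (isMeasurableFun.Build _ _ _ _ _
  mX0).
pose pX1 : {mfun Omega >-> seqR} := HB.pack X1 (isMeasurableFun.Build _ _ _ _ _
  mX1).
pose g (x : R) := expR (c * x - c ^+ 2 / 2).
have mg : measurable_fun [set: R] g.
  by apply: measurableT_comp => //; apply: measurable_funB => //.
have mgxi : measurable_fun [set: Omega] (fun w => g (xi m w)).
  exact: measurableT_comp.
have g0 x : (0 <= g x)%R by exact: expR_ge0.
pose Q : {measure set Omega -> \bar R} := density P mgxi (fun w => g0 (xi m w)).
transitivity (\int[pushforward P pX1]_y f y).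
  by rewrite ge0_integral_pushforward// preimage_setT.
transitivity (\int[pushforward Q pX0]_y f y); last first.
  rewrite ge0_integral_pushforward// preimage_setT.
  rewrite (@ge0_integral_density _ _ _ P Q (fun w => g (xi m w)))//.
  - by apply: measurableT_comp.
  - by move=> w; exact: f0.
apply: eq_measure_integral => A mA _.
apply: (@measure_unique _ R seqR boxes (fun=> setT) _ _ _ _
  (pushforward P pX1) (pushforward Q pX0)) => //.
- exact: measurable_boxes.
- exact: boxes_setI.
- move=> _; exists 0%N, (fun=> setT); split => //.
  by apply/seteqP; split.
- by rewrite bigcup_const.
- move=> {A mA} _ [n [B [mB BT ->]]]; rewrite /pushforward/=.
  pose B' k : set R := [set x | B k (x + c *+ (k == m))%R].
  have mB' k : measurable (B' k).
    have h : measurable_fun [set: R] (fun x => x + c *+ (k == m))%R.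
      exact: measurable_funD.
    by rewrite -[B' k]setTI; exact: h.
  pose E := [set w | forall k, k != m -> B k (xi k w)].
  have mE : measurable E.
    rewrite (_ : E = \bigcap_(k in [set k | k != m]) (xi k @^-1` B k)).
      by apply: bigcap_measurableType => k _; rewrite -[X in measurable
        X]setTI; exact: measurable_funP.
    by apply/seteqP; split.
  transitivity (normal_prob 0 1 (B' m) * P E).
    rewrite -(@iid_split B n m _ mB BT (mB' m)); congr (P _).
    apply/seteqP; split => w /=; rewrite /B'/= ?eqxx.
      move=> wB; split; first by have := wB m; rewrite /X1 eqxx.
      by move=> k km; have := wB k; rewrite /X1 (negbTE km) addr0.
    move=> [wm wE] k; rewrite /X1; case: eqVneq => [->//|km].
    by rewrite addr0; exact: wE.
  have -> : B' m = [set x | B m (x + c)%R] by rewrite /B' eqxx.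
  rewrite normal_prob_shiftE//.
  pose h (x : R) := (g x * \1_(B m) x)%:E.
  have mh : measurable_fun [set: R] h.
    by apply/measurable_EFinP; apply: measurable_funM.
  have h0 x : 0 <= h x by rewrite lee_fin mulr_ge0.
  have PE : (fine (P E))%:E = P E by rewrite fineK ?fin_num_measure.
  have mY : measurable_fun [set: Omega] (xi m : Omega -> measurableTypeR R).
    by move=> _ C mC; exact: (measurable_funP (xi m) measurableT C mC).
  pose Y : {mfun Omega >-> measurableTypeR R} :=
    HB.pack (xi m : Omega -> measurableTypeR R) (isMeasurableFun.Build _ _ _ _
      _ mY).
  (* Independence in terms of measures: under [P] restricted to [E], the law of [xi m] is the normal
     law multiplied by the constant [P E]. *)
  transitivity (\int[pushforward (mrestr P mE) Y]_x h x).
    apply/esym; apply: (eq_trans (@ge0_integral_density _ (measurableTypeR R) R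
      (normal_prob 0 1) (pushforward (mrestr P mE) Y)
      (fun=> fine (P E)) h _ _ _ _ _)) => //.
    - by move=> x; rewrite fine_ge0.
    - move=> A mA; rewrite integral_cst//= PE.
      rewrite [RHS]muleC; exact: (@iid_split B n m).
    - rewrite ge0_integralZr ?lee_fin ?fine_ge0// PE; congr (_ * _).
      rewrite [RHS]integral_mkcond; apply: eq_integral => x _.
      by rewrite epatch_indic /h EFinM.
  rewrite ge0_integral_pushforward// preimage_setT.
  rewrite (@ge0_integral_density _ _ _ P _ (\1_E))//; last 3 first.
  - move=> A mA; rewrite integral_indic//.
    by rewrite setIC.
  - exact: measurableT_comp.
  - by move=> w; exact: h0.
  rewrite /Q/= /density [RHS]integral_mkcond; apply: eq_integral => w _ /=.
  rewrite epatch_indic /h /= -!EFinM; congr (_%:E); rewrite -mulrA;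
    congr (_ * _)%R.
  rewrite !indicE -natrM mulnb; congr ((nat_of_bool _)%:R); apply/idP/idP.
    move=> /andP[/set_mem wm /set_mem wE]; apply/mem_set => k.
    by rewrite /X0; case: (eqVneq k m) => [->//|]; exact: wE.
  move=> /set_mem wB; apply/andP; split; apply/mem_set; first exact: wB.
  by move=> k _; exact: wB.
- by move=> _; rewrite [X in X < _]probability_setT ltry.
Qed.

End gaussian_shift.

(** * Extremal problem *)

Section real_bounds.
Context {R : realType}.
Implicit Types (x y p b : R).

Lemma invrS_le_lnB y : 0 < y -> (y + 1)^-1 <= ln (y + 1) - ln y.
Proof.
move=> y0; have y10 : 0 < y + 1 by rewrite addr_gt0.
have := @le_ln1Dx R (- (y + 1)^-1).
rewrite (_ : 1 - (y + 1)^-1 = y / (y + 1)); last by field; rewrite gt_eqF.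
rewrite lnM ?posrE ?invr_gt0// lnV ?posrE// => h.
by rewrite -lerN2 opprB h// ltrN2 invf_lt1// ltrDr.
Qed.

Lemma powR_gap_ge y p : 0 < y -> 0 < p ->
  y `^ p * p / (y + 1) <= (y + 1) `^ p - y `^ p.
Proof.
move=> y0 p0; have y10 : 0 < y + 1 by rewrite addr_gt0.
have -> : (y + 1) `^ p = y `^ p * expR (p * (ln (y + 1) - ln y)).
  by rewrite /powR !gt_eqF// -expRD; congr expR; ring.
have ll := invrS_le_lnB y0.
have := expR_ge1Dx (p * (ln (y + 1) - ln y)).
have : p * (y + 1)^-1 <= p * (ln (y + 1) - ln y) by rewrite ler_pM2l.
move=> pl pe; rewrite -mulrA -[X in _ - X]mulr1 -mulrBr.
by rewrite ler_wpM2l ?powR_ge0//; lra.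
Qed.

Lemma powR_diff_le x y p : 0 < x -> x <= y -> 0 < p ->
  y `^ p - x `^ p <= y `^ p * p * (y - x) / x.
Proof.
move=> x0 xy p0; have y0 : 0 < y by exact: lt_le_trans xy.
have -> : x `^ p = y `^ p * expR (- (p * (ln y - ln x))).
  by rewrite /powR !gt_eqF// -expRD; congr expR; ring.
have ll : ln y - ln x <= (y - x) / x.
  have := @le_ln1Dx R ((y - x) / x).
  rewrite (_ : 1 + (y - x) / x = y / x); last by field; rewrite gt_eqF.
  rewrite lnM ?posrE ?invr_gt0// lnV ?posrE//; apply.
  by rewrite (@lt_le_trans _ _ 0)// mulr_ge0 ?subr_ge0// ltW// invr_gt0.
have := expR_ge1Dx (- (p * (ln y - ln x))).
have : p * (ln y - ln x) <= p * ((y - x) / x) by rewrite ler_pM2l.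
move=> pl pe; rewrite -[X in X - _]mulr1 -mulrBr -!mulrA.
by rewrite ler_wpM2l ?powR_ge0//; lra.
Qed.

(** The common factor [y^p p] of the two preceding bounds cancels, leaving a ratio free of [p],
    hence uniform in alpha. With [d = y - x], [1 + d (d + 2)] is the square [(d + 1)^2] met in
    [sum_sqr_expR_le]. *)
Lemma powR_gap_ratio x y p : 1 <= x -> x <= y -> 0 < p ->
  y `^ p - x `^ p <= (y - x) * (y - x + 2) * ((y + 1) `^ p - y `^ p).
Proof.
move=> x1 xy p0; have x0 : 0 < x by lra.
have y0 : 0 < y by lra.
apply: (le_trans (powR_diff_le x0 xy p0)).
have h := powR_gap_ge y0 p0.
have d0 : 0 <= (y - x) * (y - x + 2) by rewrite mulr_ge0; lra.
apply: (le_trans _ (ler_wpM2l d0 h)).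
have yp : 0 < y `^ p by rewrite powR_gt0.
rewrite [leRHS](_ : _ = y `^ p * p * (y - x) * ((y - x + 2) / (y + 1)));
  last by ring.
rewrite ler_wpM2l//; first by rewrite mulr_ge0 ?subr_ge0// mulr_ge0// ltW.
rewrite -div1r ler_pdivrMr// mulrAC ler_pdivlMr; last by lra.
(* The inequality left is [(x - 1) (y - x + 1) >= 0]. *)
by nra.
Qed.

(* Bounds the sum of [(i + 1)^2 exp (- 2 b i)]. *)
Definition spread_cst b : R := (Num.min 1 (b / 2) ^+ 2 * (1 - expR (- b)))^-1.

Lemma spread_cst_gt0 b : 0 < b -> 0 < spread_cst b.
Proof.
move=> b0; rewrite invr_gt0 mulr_gt0//.
  by rewrite exprn_gt0// lt_min ltr01 divr_gt0.
by rewrite subr_gt0 -expR0 ltr_expR oppr_lt0.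
Qed.

(** With [c = min 1 (b / 2)], [c (i + 1) <= exp (b i / 2)]; so the square costs at most
    [c^-2 exp (b i)], and a geometric series of ratio [exp (- b)] remains. *)
Lemma sum_sqr_expR_le b (m : nat) : 0 < b ->
  \sum_(k < m.+1) (m%:R - k%:R + 1) ^+ 2 * expR (- (2 * b * (m%:R - k%:R)))
  <= spread_cst b.
Proof.
move=> b0; rewrite (reindex_inj rev_ord_inj)/=.
set c := Num.min 1 (b / 2).
have c0 : 0 < c by rewrite lt_min ltr01 divr_gt0.
have e1 : 0 < 1 - expR (- b) by rewrite subr_gt0 -expR0 ltr_expR oppr_lt0.
rewrite (@le_trans _ _ (\sum_(k < m.+1) (c ^+ 2)^-1 * expR (- b) ^+ k))//.
  apply: ler_sum => -[k /= km] _; rewrite subSS natrB// opprB addrCA subrr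
    addr0.
  have ck : c * (k%:R + 1) <= expR (b * k%:R / 2).
    rewrite (le_trans _ (expR_ge1Dx _))// mulrDr mulr1 addrC lerD//.
      by rewrite ge_min lexx.
    by rewrite mulrAC ler_wpM2r// ge_min lexx orbT.
  rewrite -expRM_natl mulrN -ler_pdivrMl ?invr_gt0 ?exprn_gt0// invrK mulrA.
  rewrite -ler_pdivlMr ?expR_gt0// -expRN -expRD.
  rewrite (_ : _ - _ = b * k%:R / 2 + b * k%:R / 2); last by field.
  rewrite expRD -expr2 -exprMn ler_pXn2r// nnegrE ?expR_ge0//.
  by rewrite mulr_ge0 ?addr_ge0// ltW.
rewrite -mulr_sumr /spread_cst -/c [leRHS]invfM ler_wpM2l//.
  by rewrite invr_ge0 exprn_ge0// ltW.
rewrite -[leRHS]mul1r ler_pdivlMr// mulrC.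
have := subrX1 (expR (- b)) m.+1.
have := exprn_ge0 m.+1 (expR_ge0 (- b)).
by nra.
Qed.

End real_bounds.

Section ellipsoids.
Context {R : realType}.
Implicit Types (kappa : R * R * R) (eta : nat -> R).

Lemma eseries_delta (f : nat -> \bar R) (m : nat) :
  (forall k, k != m -> f k = 0%E) -> (\sum_(0 <= k <oo) f k)%E = f m.
Proof.
move=> f0; apply: lim_near_cst => //.
near=> n; rewrite big_mkord.
have mn : (m < n)%N by near: n; exact: nbhs_infty_gt.
by rewrite (bigD1 (Ordinal mn))//= big1 ?adde0// => i im; exact: f0.
Unshelve. all: by end_near. Qed.

Lemma eseries_le_fin (f : nat -> R) (x : R) (m : nat) :
  (forall k, 0 <= f k) -> (forall n, (m <= n)%N -> \sum_(k < n) f k <= x) ->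
  (\sum_(0 <= k <oo) (f k)%:E <= x%:E)%E.
Proof.
move=> f0 fx; apply: lime_le.
  by apply: is_cvg_nneseries => k _ _; rewrite lee_fin.
near=> n; rewrite sumEFin lee_fin big_mkord; apply: fx.
by near: n; exact: nbhs_infty_ge.
Unshelve. all: by end_near. Qed.

Lemma sum_le_eseries (f : nat -> R) (x : R) (n : nat) :
  (forall k, 0 <= f k) -> (\sum_(0 <= k <oo) (f k)%:E <= x%:E)%E ->
  \sum_(k < n) f k <= x.
Proof.
move=> f0 fx; rewrite -lee_fin -(big_mkord xpredT) -sumEFin.
apply: le_trans fx; apply: nneseries_lim_ge => k _ _.
by rewrite lee_fin.
Qed.

Lemma term_le_eseries (f : nat -> R) (x : R) (m : nat) :
  (forall k, 0 <= f k) -> (\sum_(0 <= k <oo) (f k)%:E <= x%:E)%E -> f m <= x.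
Proof.
move=> f0 /(sum_le_eseries m.+1 f0); apply: le_trans.
by rewrite big_ord_recr/= lerDr sumr_ge0.
Qed.

(** Each term of the convergent sum is at most 1, hence so is its base, and on [[0, 1]] raising the
    exponent from [q] to 2 decreases the power. *)
Lemma sum_sqr_le_ellipsoid kappa eta (n : nat) :
  0 < q_of kappa <= 2 ->
  (\sum_(0 <= k <oo)
     (`|a_seq kappa k * sigma_seq kappa k * eta k| `^ q_of kappa)%:E <= 1)%E ->
  \sum_(k < n) (a_seq kappa k * sigma_seq kappa k * eta k) ^+ 2 <= 1.
Proof.
move=> /andP[q0 q2] H.
have p0 k : 0 <= `|a_seq kappa k * sigma_seq kappa k * eta k| `^ q_of kappa.
  exact: powR_ge0.
apply: le_trans (sum_le_eseries n p0 H); apply: ler_sum => k _.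
have := term_le_eseries k p0 H.
set x := `|_| => x1.
have x0 : 0 <= x by exact: normr_ge0.
rewrite -real_normK ?num_real// -/x -powR_mulrn//.
have [->|xn0] := eqVneq x 0.
  by rewrite !powR0 ?gt_eqF// pnatr_eq0.
apply: ger_powR => //; rewrite lt_neqAle eq_sym xn0 x0/=.
rewrite leNgt; apply/negP => x1'; move: x1; apply/negP; rewrite -ltNge.
rewrite (_ : 1 = 1 `^ q_of kappa); last by rewrite powR1.
by rewrite gt0_ltr_powR// nnegrE.
Qed.

(* Linear-programming duality in the variables [w k = (sigma_k eta_k)^2]: since
   [sum w >= r^2] and [sum a_k^2 w_k <= 1 <= a_m^2 r^2], the coordinates beyond
   [m] cannot carry more mass than a weighted sum of the first ones. This needs
   only the exponent 2 of the ellipsoid, which contains every smaller one. *)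
Lemma ellipsoid_head kappa eta (b h r : R) (m : nat) :
  0 < alpha_of kappa -> 0 < b -> b <= beta_of kappa -> 0 < q_of kappa <= 2 ->
  0 < r -> 1 <= a_seq kappa m * r ->
  Theta kappa r eta -> (forall k, (k <= m)%N -> eta k ^+ 2 <= h) ->
  r ^+ 2 <= h * spread_cst b * sigma_seq kappa m ^+ 2.
Proof.
move=> al0 b0 bb q02 r0 mr [_ Hq Hr] Hh.
pose al := alpha_of kappa.
pose p := al * 2%:R.
have p0 : 0 < p by rewrite mulr_gt0.
pose N (k : nat) : R := k.+1%:R.
have N0 k : 0 < N k by rewrite ltr0n.
have ap k : a_seq kappa k ^+ 2 = N k `^ p.
  by rewrite /p powRrM powR_mulrn// powR_ge0.
pose w k := sigma_seq kappa k ^+ 2 * eta k ^+ 2.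
have w0 k : 0 <= w k by rewrite mulr_ge0// sqr_ge0.
pose D := (N m + 1) `^ p - N m `^ p.
have D0 : 0 < D.
  rewrite (lt_le_trans _ (powR_gap_ge (N0 m) p0))//.
  by rewrite divr_gt0 ?mulr_gt0 ?powR_gt0// addr_gt0.
have DN : 0 < D + N m `^ p by rewrite addr_gt0// powR_gt0.
(* Dual weights: for [k <= m], [D] times the weight plus the squared ellipsoid weight [N k ^ p] is
   the constant [D + N m ^ p]. For [k > m], [N k ^ p] alone is at least this constant. *)
pose S := \sum_(k < m.+1) (1 + (N m `^ p - N k `^ p) / D) * w k.
have Hn n : (m < n)%N -> \sum_(k < n) w k <= (S * D + 1) / (D + N m `^ p).
  move=> mn; rewrite ler_pdivlMr// mulr_suml.
  have -> : S * D = \sum_(k < n | (k < m.+1)%N) (D + N m `^ p - N k `^ p) * w k.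
    rewrite /S (big_ord_widen n (fun k => (1 + (N m `^ p - N k `^ p) / D) * w
      k))//.
    rewrite mulr_suml; apply: eq_bigr => k _; field.
    by rewrite gt_eqF.
  have := sum_sqr_le_ellipsoid n q02 Hq; rewrite -(lerD2l (\sum_(k < n | (k <
    m.+1)%N) (D + N m `^ p - N k `^ p) * w k)).
  apply: le_trans; rewrite [X in _ <= X + _]big_mkcond -big_split/=.
  apply: ler_sum => k _.
  rewrite (_ : (_ * _ * _) ^+ 2 = N k `^ p * w k); last first.
    by rewrite /w -ap !exprMn mulrA.
  case: ifPn => [km|]; first lra.
  rewrite -leqNgt => mk; rewrite add0r mulrC ler_wpM2r// /D subrK.
  by rewrite /N natr1 ge0_ler_powR ?nnegrE// ?ler_nat// ltW.
(* From [r^2 (D + N m ^ p) <= S D + 1], the hypothesis [r^2 N m ^ p >= 1] removes the 1, and [D] is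
   divided out. *)
have rS : r ^+ 2 <= S.
  have : r ^+ 2 <= (S * D + 1) / (D + N m `^ p).
    rewrite -lee_fin; apply: (le_trans Hr); exact: (eseries_le_fin w0 Hn).
  rewrite ler_pdivlMr// mulrDr.
  have : 1 <= r ^+ 2 * N m `^ p.
    by rewrite -ap -exprMn exprn_ege1// mulrC.
  move=> h1 h2; rewrite -(ler_pM2r D0); lra.
apply: (le_trans rS).
have h0 : 0 <= h by apply: le_trans (Hh m _) => //; exact: sqr_ge0.
apply: (@le_trans _ _ (h * (\sum_(k < m.+1) (m%:R - k%:R + 1) ^+ 2 *
    expR (- (2 * b * (m%:R - k%:R)))) * sigma_seq kappa m ^+ 2)); last first.
  by rewrite ler_wpM2r ?sqr_ge0// ler_wpM2l// sum_sqr_expR_le.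
rewrite mulr_sumr mulr_suml; apply: ler_sum => -[k /= km] _.
have NN : N m - N k = m%:R - k%:R by rewrite /N -!natr1; ring.
have km' : (k%:R : R) <= m%:R by rewrite ler_nat.
have c1 : 1 + (N m `^ p - N k `^ p) / D <= (m%:R - k%:R + 1) ^+ 2.
  have := @powR_gap_ratio R (N k) (N m) p; rewrite NN -/D => g.
  have {g} : N m `^ p - N k `^ p <= (m%:R - k%:R) * (m%:R - k%:R + 2) * D.
    by apply: g => //; rewrite /N ?ler1n// ler_nat.
  by rewrite -ler_pdivrMr// expr2; lra.
have c2 : w k <= h * (expR (- (2 * b * (m%:R - k%:R))) * sigma_seq kappa m ^+
  2).
  rewrite /w mulrC ler_pM ?sqr_ge0//; first exact: Hh.
  rewrite /sigma_seq -!expRM_natl -expRD ler_expR.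
  have : b * (m%:R - k%:R) <= beta_of kappa * (m%:R - k%:R).
    by rewrite ler_wpM2r// subr_ge0.
  by rewrite -!natr1; lra.
apply: le_trans (ler_pM _ (w0 k) c1 c2) _; last by rewrite le_eqVlt;
  apply/orP; left; apply/eqP; ring.
rewrite addr_ge0// mulr_ge0 ?invr_ge0 ?(ltW D0)// subr_ge0 ge0_ler_powR ?nnegrE
  ?(ltW p0)//.
by rewrite ler_nat.
Qed.

Lemma spike_Theta kappa (m : nat) (v r : R) :
  0 < q_of kappa -> 0 <= v -> 0 <= r ->
  a_seq kappa m * sigma_seq kappa m * v <= 1 -> r <= sigma_seq kappa m * v ->
  Theta kappa r (fun k => v *+ (k == m)).
Proof.
move=> q0 v0 r0 av rv; split.
- rewrite /ell2 (eseries_delta (m := m)) ?ltry// => k /negbTE ->.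
  by rewrite expr0n.
- rewrite (eseries_delta (m := m)) => [|k /negbTE ->].
    rewrite eqxx lee_fin (_ : 1 = 1 `^ q_of kappa); last by rewrite powR1.
    rewrite ge0_ler_powR ?nnegrE ?(ltW q0)// ger0_norm// !mulr_ge0//.
      exact: powR_ge0.
    exact: expR_ge0.
  by rewrite mulr0 normr0 powR0// gt_eqF.
- rewrite (eseries_delta (m := m)) => [|k /negbTE ->].
    by rewrite eqxx lee_fin -exprMn ler_pXn2r// nnegrE// (le_trans r0).
  by rewrite expr0n mulr0.
Qed.

End ellipsoids.

Section extremal_problem.
Context {R : realType}.
Implicit Types (kappa : R * R * R) (eta : nat -> R) (e r x v : R).

Lemma sigma_seq_gt0 kappa (m : nat) : 0 < sigma_seq kappa m.
Proof. exact: expR_gt0. Qed.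

Lemma a_seq_gt0 kappa (m : nat) : 0 < a_seq kappa m.
Proof. by rewrite powR_gt0. Qed.

Lemma u_ext_spike kappa (m : nat) e v r : 0 < e -> 0 <= v ->
  Theta kappa r (fun k => v *+ (k == m)) ->
  (u_ext e kappa r <= (v ^+ 2 / e ^+ 2)%:E)%E.
Proof.
move=> e0 v0 Tv.
have -> : ((v ^+ 2 / e ^+ 2)%:E = sqrte ((v ^+ 2 / e ^+ 2)%:E ^+ 2))%E.
  by rewrite sqrte_sqr/= ger0_norm// divr_ge0// sqr_ge0.
rewrite /u_ext lee_sqrt ?sqre_ge0//.
apply: (@le_trans _ _ ((2 * e ^+ 4)^-1%:E * (v ^+ 4)%:E)%E).
  apply: lee_wpmul2l; first by rewrite lee_fin invr_ge0 mulr_ge0// exprn_ge0//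
    ltW.
  apply: ereal_inf_lbound; exists (fun k => v *+ (k == m)) => //.
  rewrite (eseries_delta (m := m)) ?eqxx// => k /negbTE ->.
  by rewrite expr0n.
have e4 : 0 < e ^+ 4 by rewrite exprn_gt0.
rewrite -EFin_expe -EFinM lee_fin.
rewrite (_ : (v ^+ 2 / e ^+ 2) ^+ 2 = (e ^+ 4)^-1 * v ^+ 4); last first.
  by field; rewrite gt_eqF.
rewrite ler_wpM2r ?exprn_even_ge0// lef_pV2 ?posrE ?mulr_gt0//; lra.
Qed.

(** For an almost minimizing [eta] the whole sum of fourth powers, hence each term, is at most
    [2 e^4 x^2]; the resulting [sqrt 2] is rounded up to 2. As [u_ext] is [+oo] on an empty
    alternative, the hypothesis also provides a member. *)
Lemma u_ext_lt kappa e r x : 0 < e -> 0 <= x ->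
  (u_ext e kappa r < x%:E)%E ->
  exists2 eta, Theta kappa r eta & forall k, eta k ^+ 2 <= 2 * x * e ^+ 2.
Proof.
move=> e0 x0 ux.
have [//|H] := pselect (exists2 eta, Theta kappa r eta &
  forall k, eta k ^+ 2 <= 2 * x * e ^+ 2).
exfalso; move: ux; apply/negP; rewrite -leNgt.
have -> : (x%:E = sqrte (x%:E ^+ 2))%E.
  by rewrite sqrte_sqr/= ger0_norm.
have e4 : 0 < 2 * e ^+ 4 by rewrite mulr_gt0// exprn_gt0.
rewrite /u_ext lee_sqrt; last first.
  apply: mule_ge0; first by rewrite lee_fin invr_ge0 ltW.
  apply/ereal_infP => _ [eta _ <-].
  by apply: nneseries_ge0 => k _ _; rewrite lee_fin exprn_even_ge0.
rewrite -EFin_expe -lee_pdivrMl ?invr_gt0// invrK -EFinM.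
apply/ereal_infP => _ [eta Teta <-]; rewrite leNgt; apply/negP => lt.
apply: H; exists eta => // k; rewrite -ler_sqr ?nnegrE ?sqr_ge0//; last first.
  by rewrite mulr_ge0 ?exprn_ge0 ?mulr_ge0 ?(ltW e0).
have f0 j : 0 <= eta j ^+ 4 by rewrite exprn_even_ge0.
have := term_le_eseries k f0 (ltW lt).
rewrite -exprM => /le_trans; apply.
rewrite (_ : (2 * x * e ^+ 2) ^+ 2 = 2 * (2 * e ^+ 4 * x ^+ 2)); last by ring.
by rewrite ler_peMl ?(mulr_ge0 (ltW e4) (sqr_ge0 _))// ler1n.
Qed.

(** Contrapositive of [u_ext_lt]; any constant above its factor 2 could replace 3. *)
Lemma u_ext_ge kappa e r x : 0 < e -> 0 < x ->
  (forall eta, Theta kappa r eta -> exists k, x * e ^+ 2 <= eta k ^+ 2) ->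
  ((x / 3)%:E <= u_ext e kappa r)%E.
Proof.
move=> e0 x0 H; rewrite leNgt; apply/negP => /u_ext_lt[]//.
  by rewrite divr_ge0// ltW.
move=> eta /H[k hk] /(_ k); have e2 : 0 < e ^+ 2 by rewrite exprn_gt0.
apply/negP; rewrite -ltNge (lt_le_trans _ hk)// ltr_pM2r//; lra.
Qed.

End extremal_problem.

(** * Bayes risk *)

Section mean_value.
Context {d} {T : measurableType d} {R : realType}.
Variable P : probability T R.

(** Integrability and value of the mean in one predicate. It is stable under sums and nonnegative
    multiples, and turns pointwise comparison into comparison of reals. *)
Definition has_mean (f : T -> R) (x : R) : Prop :=
  [/\ measurable_fun [set: T] f, forall w, 0 <= f w &
      (\int[P]_w (f w)%:E)%E = x%:E].

Lemma has_mean_cst (c : R) : 0 <= c -> has_mean (fun=> c) c.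
Proof.
by move=> c0; split => //; rewrite integral_cst//= probability_setT mule1.
Qed.

Lemma has_meanD f g x y :
  has_mean f x -> has_mean g y -> has_mean (fun w => f w + g w) (x + y).
Proof.
move=> [mf f0 fx] [mg g0 gy]; split.
- exact: measurable_funD.
- by move=> w; rewrite addr_ge0.
- under eq_integral do rewrite EFinD.
  rewrite ge0_integralD//; first by rewrite fx gy.
  + by move=> w _; rewrite lee_fin.
  + exact/measurable_EFinP.
  + by move=> w _; rewrite lee_fin.
  + exact/measurable_EFinP.
Qed.

Lemma has_meanZ c f x : 0 <= c -> has_mean f x ->
  has_mean (fun w => c * f w) (c * x).
Proof.
move=> c0 [mf f0 fx]; split.
- exact: measurable_funM.
- by move=> w; rewrite mulr_ge0.
- under eq_integral do rewrite EFinM.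
  rewrite ge0_integralZl//; first by rewrite fx.
  + exact/measurable_EFinP.
  + by move=> w _; rewrite lee_fin.
Qed.

Lemma has_mean_sum (n : nat) (f : 'I_n -> T -> R) (x : 'I_n -> R) :
  (forall i, has_mean (f i) (x i)) ->
  has_mean (fun w => \sum_i f i w) (\sum_i x i).
Proof.
elim: n f x => [|n IH] f x fx.
  under eq_fun do rewrite big_ord0.
  by rewrite big_ord0; exact: has_mean_cst.
under eq_fun do rewrite big_ord_recl.
by rewrite big_ord_recl; apply: has_meanD => //; exact: IH.
Qed.

Lemma le_has_mean f g x y : has_mean f x -> has_mean g y ->
  (forall w, f w <= g w) -> x <= y.
Proof.
move=> [mf f0 fx] [mg g0 gy] fg; rewrite -lee_fin -fx -gy.
apply: ge0_le_integral => //.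
- by move=> w _; rewrite lee_fin.
- exact/measurable_EFinP.
- exact/measurable_EFinP.
- by move=> w _; rewrite lee_fin.
Qed.

Lemma bounded_has_mean (f : T -> R) : measurable_fun [set: T] f ->
  (forall w, 0 <= f w <= 1) -> has_mean f (fine ('E_P[f])%E).
Proof.
move=> mf f01; split => //.
  by move=> w; have /andP[] := f01 w.
rewrite unlock fineK// ge0_fin_numE; last first.
  by apply: integral_ge0 => w _; rewrite lee_fin; have /andP[] := f01 w.
apply: (@le_lt_trans _ _ (\int[P]_w (cst 1%:E w))%E); last first.
  by rewrite integral_cst//= probability_setT mule1 ltry.
apply: ge0_le_integral => //.
- by move=> w _; rewrite lee_fin; have /andP[] := f01 w.
- exact/measurable_EFinP.
- by move=> w _; rewrite lee_fin; have /andP[] := f01 w.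
Qed.

End mean_value.

Section bayes_risk.
Context {R : realType} {d : measure_display} {Omega : measurableType d}
  {P : probability Omega R}.
Variables (xi : nat -> {RV P >-> R}) (hxi : iid_std_normal xi).
Local Notation seqR := (g_sigma_algebraType (@cylinders R)).

Lemma test_compl (psi : (nat -> R) -> R) : is_test psi ->
  is_test (fun y => 1 - psi y).
Proof.
move=> [mpsi psi01]; split; first exact: measurable_funB.
by move=> y; have /andP[p0 p1] := psi01 y; apply/andP; split; lra.
Qed.

Lemma test_has_mean (e : R) (eta : nat -> R) (psi : (nat -> R) -> R) :
  is_test psi ->
  has_mean P (fun w => psi (observation xi e eta w)) (Exp xi e eta psi).
Proof.
move=> [mpsi psi01]; apply: bounded_has_mean => //.
apply: (measurableT_comp mpsi (g := fun w => observation xi e eta w : seqR)).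
apply: measurable_fun_seq => k; apply: measurable_funD => //.
exact: measurable_funM.
Qed.

Lemma Exp_test_itv (e : R) (eta : nat -> R) (psi : (nat -> R) -> R) :
  is_test psi -> 0 <= Exp xi e eta psi <= 1.
Proof.
move=> tpsi; have E := test_has_mean e eta tpsi; case: tpsi => _ psi01.
apply/andP; split.
- apply: (le_has_mean (has_mean_cst P (lexx 0)) E) => w.
  by have /andP[] := psi01 (observation xi e eta w).
- apply: (le_has_mean E (has_mean_cst P ler01)) => w.
  by have /andP[] := psi01 (observation xi e eta w).
Qed.

Lemma beta_err_le1 (e : R) (T : set (nat -> R)) (psi : (nat -> R) -> R) :
  is_test psi -> beta_err xi e T psi <= 1.
Proof.
move=> /test_compl tpsi; rewrite /beta_err.
have [->|/set0P[eta Teta]] := eqVneq T set0; first by rewrite image_set0 sup0.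
apply: ge_sup; first by exists (Exp xi e eta (fun y => 1 - psi y)); exists eta.
by move=> _ [eta' _ <-]; have /andP[] := Exp_test_itv e eta' tpsi.
Qed.

Lemma Exp_le_beta_err (e : R) (T : set (nat -> R)) (psi : (nat -> R) -> R) eta :
  is_test psi -> T eta ->
  Exp xi e eta (fun y => 1 - psi y) <= beta_err xi e T psi.
Proof.
move=> /test_compl tpsi Teta; apply: ub_le_sup; last by exists eta.
by exists 1 => _ [eta' _ <-]; have /andP[] := Exp_test_itv e eta' tpsi.
Qed.

Lemma beta_err_ge0 (e : R) (T : set (nat -> R)) (psi : (nat -> R) -> R) :
  is_test psi -> 0 <= beta_err xi e T psi.
Proof.
move=> tpsi; have [T0|/set0P[eta Teta]] := eqVneq T set0.
  by rewrite /beta_err T0 image_set0 sup0.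
apply: le_trans (Exp_le_beta_err e tpsi Teta).
by have /andP[] := Exp_test_itv e eta (test_compl tpsi).
Qed.

(** Likelihood ratio against pure noise of a spike at [j], of height [B] in units of the noise
    level. *)
Definition likelihood (B : R) (j : nat) (w : Omega) : R :=
  expR (B * xi j w - B ^+ 2 / 2).

Lemma likelihood_mean (B : R) (j : nat) (f : seqR -> R) (x : R) :
  measurable_fun [set: seqR] f -> (forall y, 0 <= f y) ->
  has_mean P (fun w => f (fun k => xi k w + B *+ (k == j))) x ->
  has_mean P (fun w => f (fun k => xi k w) * likelihood B j w) x.
Proof.
move=> mf f0 [_ _ fx]; split.
- apply: measurable_funM.
    apply: (@measurableT_comp _ _ _ _ _ _ f _ (fun w => (fun k =>
      xi k w) : seqR)) => //.
    exact: measurable_fun_seq.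
  apply: measurableT_comp => //; apply: measurable_funB => //;
    exact: measurable_funM.
- by move=> w; rewrite mulr_ge0// expR_ge0.
- rewrite -fx; rewrite (gaussian_change_of_measure hxi B j (f := EFin \o f))//.
  exact/measurable_EFinP.
Qed.

Lemma measurable_exp_coordinate (B : R) (i : nat) :
  measurable_fun [set: seqR] (fun y : seqR => expR (B * y i - B ^+ 2 / 2)).
Proof.
apply: measurableT_comp => //; apply: measurable_funB => //.
by apply: measurable_funM => //; exact: measurable_fun_coordinate.
Qed.

Lemma likelihood_mean1 (B : R) (j : nat) : has_mean P (likelihood B j) 1.
Proof.
rewrite (_ : likelihood B j = (fun w => 1 * likelihood B j w)).
  by apply: (@likelihood_mean B j (fun=> 1)) => //; exact: has_mean_cst.
by apply/funext => w; rewrite mul1r.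
Qed.

(** The factor at [j] is absorbed as a shift of coordinate [j]. For [i != j] the other factor does
    not see it; for [i = j] its exponent gains [B^2]. *)
Lemma likelihood_mean2 (B : R) (i j : nat) :
  has_mean P (fun w => likelihood B i w * likelihood B j w)
    (if i == j then expR (B ^+ 2) else 1).
Proof.
apply: (@likelihood_mean B j (fun y : seqR => expR (B * y i - B ^+ 2 / 2))).
- exact: measurable_exp_coordinate.
- by move=> y; exact: expR_ge0.
- case: eqVneq => [->|ij].
    rewrite (_ : (fun _ => _) = (fun w => expR (B ^+ 2) * likelihood B j w)).
      rewrite -[X in has_mean _ _ X]mulr1.
      by apply: has_meanZ; [exact: expR_ge0|exact: likelihood_mean1].
    by apply/funext => w; rewrite /likelihood -expRD /= mulr1n; congr expR;
      field.
  under eq_fun do rewrite addr0.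
  exact: likelihood_mean1.
Qed.

(* With the uniform prior on [n] spikes and likelihood ratio [L],
   [psi + (1 - psi) L >= 1 - |L - 1| >= 1 - dl / 2 - (L - 1)^2 / (2 dl)].
   The terms are arranged so that only nonnegative functions are integrated. *)
Lemma bayes_risk_ge (e B dl : R) (m n : nat) (T : set (nat -> R))
    (psi : (nat -> R) -> R) :
  0 < dl -> (0 < n)%N -> expR (B ^+ 2) / n%:R <= dl ^+ 2 ->
  (forall i, (i < n)%N -> T (fun k => (e * B) *+ (k == m + i)%N)) ->
  is_test psi -> 1 - dl <= alpha_err xi e psi + beta_err xi e T psi.
Proof.
move=> dl0 n0 Vn Tspike [mpsi psi01].
have n0' : 0 < n%:R :> R by rewrite ltr0n.
pose f (y : seqR) : R := psi (fun k => e * y k).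
have mf : measurable_fun [set: seqR] f.
  apply: (measurableT_comp mpsi (g := fun y : seqR => (fun k =>
    e * y k) : seqR)).
  apply: measurable_fun_seq => k; apply: measurable_funM => //.
  exact: measurable_fun_coordinate.
have f01 y : 0 <= f y <= 1 by exact: psi01.
have alphaE : has_mean P (fun w => f (fun k => xi k w)) (alpha_err xi e psi).
  rewrite (_ : (fun w => _) = (fun w => psi (observation xi e (fun=> 0) w))).
    exact: test_has_mean.
  by apply/funext => w; congr psi; apply/funext => k;
    rewrite /observation add0r.
pose b i := Exp xi e (fun k => (e * B) *+ (k == m + i)%N) (fun y => 1 - psi y).
have bE i : has_mean P (fun w => (1 - f (fun k =>
  xi k w)) * likelihood B (m + i) w) (b i).
  apply: (@likelihood_mean B (m + i) (fun y => 1 - f y)).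
  - exact: measurable_funB.
  - by move=> y; rewrite subr_ge0; have /andP[] := f01 y.
  - rewrite (_ : (fun w => _) = (fun w => 1 - psi (observation xi e
        (fun k => (e * B) *+ (k == m + i)%N) w))).
      by apply: (@test_has_mean _ _ (fun y => 1 - psi y)); exact: test_compl.
    apply/funext => w; congr (1 - psi _); apply/funext => k.
    by rewrite /observation -mulrnAr mulrDr addrC.
have bT i : (i < n)%N -> b i <= beta_err xi e T psi.
  by move=> ni; apply: Exp_le_beta_err => //; exact: Tspike.
pose L w := n%:R^-1 * \sum_(i < n) likelihood B (m + i) w.
have LE : has_mean P L 1.
  rewrite -[X in has_mean _ _ X](mulVf (lt0r_neq0 n0')).
  apply: has_meanZ; first by rewrite invr_ge0 ltW.
  rewrite [X in has_mean _ _ X](_ : _ = \sum_(i < n) 1); last first.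
    by rewrite sumr_const card_ord.
  by apply: has_mean_sum => i; exact: likelihood_mean1.
have L2E : has_mean P (fun w => L w ^+ 2)
    (n%:R^-1 ^+ 2 * \sum_(i < n) \sum_(j < n)
       (if (m + i == m + j)%N then expR (B ^+ 2) else 1)).
  rewrite (_ : (fun _ => _) = (fun w => n%:R^-1 ^+ 2 *
      \sum_(i < n) \sum_(j < n) likelihood B (m + i) w * likelihood B (m + j)
        w)).
    apply: has_meanZ; first by rewrite sqr_ge0.
    apply: has_mean_sum => i; apply: has_mean_sum => j.
    exact: likelihood_mean2.
  apply/funext => w; rewrite /L exprMn; congr (_ * _).
  by rewrite expr2 mulr_suml; apply: eq_bigr => i _; rewrite mulr_sumr.
(* There are [n] diagonal terms [exp (B^2)] and [n (n - 1)] terms equal to 1. *)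
have L2le : n%:R^-1 ^+ 2 * \sum_(i < n) \sum_(j < n)
       (if (m + i == m + j)%N then expR (B ^+ 2) else 1) <= 1 + dl ^+ 2.
  rewrite (eq_bigr (fun=> expR (B ^+ 2) + (n%:R - 1))) => [|i _].
    rewrite sumr_const card_ord -mulr_natr.
    rewrite (_ : _ * _ = expR (B ^+ 2) / n%:R + (1 - n%:R^-1)); last first.
      by field; rewrite gt_eqF.
    have := Vn; have : 0 <= n%:R^-1 :> R by rewrite invr_ge0 ltW.
    lra.
  rewrite (bigD1 i)//= eqxx; congr (_ + _).
  rewrite (eq_bigr (fun=> 1)) => [|j ji].
    rewrite sumr_const cardC1 card_ord -[in RHS](prednK n0) -natr1 addrK.
    by [].
  by rewrite eqn_add2l eq_sym (inj_eq val_inj) (negbTE ji).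
have bLE : has_mean P (fun w => (1 - f (fun k => xi k w)) * L w) (n%:R^-1 *
  \sum_(i < n) b i).
  rewrite (_ : (fun _ => _) = (fun w => n%:R^-1 *
      \sum_(i < n) (1 - f (fun k => xi k w)) * likelihood B (m + i) w)).
    apply: has_meanZ; first by rewrite invr_ge0 ltW.
    exact: has_mean_sum.
  by apply/funext => w; rewrite /L mulrCA -mulr_sumr.
have bavg : n%:R^-1 * \sum_(i < n) b i <= beta_err xi e T psi.
  rewrite ler_pdivrMl// mulrC mulr_natr -[X in _ *+ X]card_ord -sumr_const.
  by apply: ler_sum => i _; exact: bT.
have d1 : 0 <= dl^-1 by rewrite invr_ge0 ltW.
have d2 : 0 <= (2 * dl)^-1 by rewrite invr_ge0 mulr_ge0// ltW.
have lhs := has_meanD (has_mean_cst P ler01) (has_meanZ d1 LE).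
have rhs := has_meanD (has_meanD alphaE bLE)
  (has_meanD (has_mean_cst P (ltW (divr_gt0 dl0 (ltr0Sn R 1))))
             (has_meanZ d2 (has_meanD L2E (has_mean_cst P ler01)))).
have := le_has_mean lhs rhs.
have pt w : 1 + dl^-1 * L w <= f (fun k => xi k w) + (1 - f (fun k =>
  xi k w)) * L w +
    (dl / 2 + (2 * dl)^-1 * (L w ^+ 2 + 1)).
  have /andP[] := f01 (fun k => xi k w); set F := f _; set X := L w => F0 F1.
  rewrite -subr_ge0.
  (* Multiplied by [2 dl], the difference is [dl^2 + 2 dl (1 - F) (X - 1) + (X - 1)^2]; the square
     is completed, and [(1 - F)^2 <= 1]. *)
  rewrite (_ : _ - _ = ((dl + (1 - F) * (X - 1)) ^+ 2 +
      (1 - (1 - F) ^+ 2) * (X - 1) ^+ 2) / (2 * dl)); last first.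
    by field; rewrite gt_eqF.
  rewrite mulr_ge0 ?invr_ge0 ?mulr_ge0 ?(ltW dl0)// addr_ge0 ?sqr_ge0//.
  rewrite mulr_ge0 ?sqr_ge0//; nra.
move=> /(_ pt).
have : (2 * dl)^-1 * (n%:R^-1 ^+ 2 * \sum_(i < n) \sum_(j < n)
       (if (m + i == m + j)%N then expR (B ^+ 2) else 1) + 1) <=
       (2 * dl)^-1 * (1 + dl ^+ 2 + 1).
  by rewrite ler_wpM2l// lerD2r.
rewrite (_ : (2 * dl)^-1 * (1 + dl ^+ 2 + 1) = dl^-1 + dl / 2); last first.
  by field; rewrite gt_eqF.
move: bavg; lra.
Qed.

End bayes_risk.

(** * Threshold tests *)

Section zeta_bound.
Context {R : realType}.

Lemma powRN_gap (y q : R) : 0 < y -> 0 < q ->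
  q * (y + 1) `^ (- (q + 1)) <= y `^ (- q) - (y + 1) `^ (- q).
Proof.
move=> y0 q0; have y10 : 0 < y + 1 by rewrite addr_gt0.
have -> : y `^ (- q) = (y + 1) `^ (- q) * expR (q * (ln (y + 1) - ln y)).
  by rewrite /powR !gt_eqF// -expRD; congr expR; ring.
have -> : (y + 1) `^ (- (q + 1)) = (y + 1) `^ (- q) / (y + 1).
  rewrite opprD powRD; last by rewrite (gt_eqF y10) implybT.
  by rewrite powR_inv1// ltW.
have ll := invrS_le_lnB y0.
have := expR_ge1Dx (q * (ln (y + 1) - ln y)).
have : q * (y + 1)^-1 <= q * (ln (y + 1) - ln y) by rewrite ler_pM2l.
move=> pl pe; rewrite mulrCA -[X in _ - X]mulr1 -mulrBr.
by rewrite ler_wpM2l ?powR_ge0//; lra.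
Qed.

(** [powRN_gap] telescopes; the induction carries the sharper bound [1 + q^-1 (1 - n^(-q))]. *)
Lemma sum_powRN_le (q : R) (n : nat) : 0 < q ->
  \sum_(k < n) k.+1%:R `^ (- (q + 1)) <= 1 + q^-1.
Proof.
move=> q0; have [->|n0] := posnP n.
  by rewrite big_ord0 addr_ge0// invr_ge0 ltW.
suff : \sum_(k < n) k.+1%:R `^ (- (q + 1)) <= 1 + q^-1 * (1 - n%:R `^ (- q)).
  by move=> /le_trans; apply; rewrite lerD2l ler_piMr ?invr_ge0 ?(ltW q0)//
    gerBl powR_ge0.
elim: n n0 => // -[_ _|n IH _].
  by rewrite big_ord1 !powR1 subrr mulr0 addr0.
rewrite big_ord_recr/=; apply: (le_trans (lerD (IH isT) (lexx _))).
rewrite -addrA lerD2l.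
have := @powRN_gap n.+1%:R q; rewrite natr1 => /(_ (ltr0Sn R n) q0).
by rewrite -ler_pdivlMl//; lra.
Qed.

End zeta_bound.

Section tails.
Context {R : realType} {d : measure_display} {Omega : measurableType d}
  {P : probability Omega R}.
Variables (xi : nat -> {RV P >-> R}) (hxi : iid_std_normal xi).
Local Notation seqR := (g_sigma_algebraType (@cylinders R)).

Lemma measurable_gt_abs (k : nat) (t : R) : measurable [set w | t < `|xi k w|].
Proof.
rewrite (_ : [set _ | _] = (fun w => `|xi k w|) @^-1` `]t, +oo[%classic).
  rewrite -[X in measurable X]setTI.
  have mn : measurable_fun [set: Omega] (fun w => `|xi k w|).
    exact: measurableT_comp.
  by apply: mn => //; exact: measurable_itv.
by apply/seteqP; split => w /=; rewrite in_itv/= andbT.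
Qed.

Lemma abs_normal_tail (k : nat) (t : R) : 0 < t ->
  (P [set w | (t < `|xi k w|)%R] <= (2 * (expR (- t ^+ 2 / 2) / t))%:E)%E.
Proof.
move=> t0; have [xiN _] := hxi.
have sym : (normal_prob 0 1 `]-oo, (- t)%R] = normal_prob 0 1 `[t, +oo[)%E.
  rewrite /normal_prob ge0_integration_by_substitutionNy.
  - apply: eq_integral => x _; rewrite /= !normal_pdfE ?oner_neq0//.
    by rewrite /normal_fun !subr0 sqrrN.
  - by apply: continuous_subspaceT; exact: continuous_normal_pdf.
  - by move=> x _; exact: normal_pdf_ge0.
apply: (@le_trans _ _ (P (xi k @^-1` `[t, +oo[ `|` xi k @^-1` `]-oo, (-
  t)%R])))%E.
  apply: le_measure; rewrite ?inE.
  - exact: measurable_gt_abs.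
  - apply: measurableU; rewrite -[X in measurable X]setTI;
    apply: measurable_funP => //; exact: measurable_itv.
  - move=> w /=; rewrite !in_itv/= andbT lter_normr => /orP[/ltW|/ltW];
    [by left|].
    by rewrite lerNr; right.
apply: le_trans (measureU2 _ _ _) _.
- by rewrite -[X in measurable X]setTI; apply: measurable_funP => //;
  exact: measurable_itv.
- by rewrite -[X in measurable X]setTI; apply: measurable_funP => //;
  exact: measurable_itv.
have e1 := xiN k `[t, +oo[%classic (measurable_itv _).
have e2 := xiN k `]-oo, (- t)%R]%classic (measurable_itv _).
rewrite /distribution /pushforward in e1 e2.
rewrite [X in (X + _)%E]e1 [X in (_ + X)%E]e2 sym mulrDl mul1r EFinD.
by rewrite leeD// normal_prob_tail.
Qed.

Lemma has_mean_le_prob (f : Omega -> R) (x c : R) (E : set Omega) :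
  has_mean P f x -> measurable E -> (forall w, f w <= \1_E w) ->
  (P E <= c%:E)%E -> x <= c.
Proof.
move=> [mf f0 fx] mE fE PE; rewrite -lee_fin -fx; apply: le_trans PE.
rewrite -[X in (_ <= P X)%E]setIT -integral_indic//.
apply: ge0_le_integral => //.
- by move=> w _; rewrite lee_fin.
- exact/measurable_EFinP.
- exact/measurable_EFinP/measurable_indic.
- by move=> w _; rewrite lee_fin.
Qed.

Lemma threshold_is_test (C : R) (L : int) (e : R) :
  is_test (threshold_test C L e).
Proof.
split; last by move=> y; rewrite /threshold_test indicE; case: (_ \in _);
  rewrite /= ?lexx ?ler01.
apply: measurable_indic.
rewrite (_ : [set y | _] =
    \bigcup_k [set y | `]e * threshold C L k, +oo[%classic `|y k|]).
  apply: bigcup_measurable => k _.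
  rewrite -[X in measurable X]setTI.
  have mn : measurable_fun [set: seqR] (fun y : seqR => `|y k|).
    apply: measurableT_comp => //; exact: measurable_fun_coordinate.
  by apply: mn => //; exact: measurable_itv.
apply/seteqP; split => y /=.
  by move=> [k yk]; exists k => //=; rewrite in_itv/= yk.
by move=> [k _]; rewrite /= in_itv/= andbT => yk; exists k.
Qed.

(** When [|eta k|] exceeds the threshold by [e s], a miss forces [|xi k| > s]. In the normal tail
    only the factor [1 / s] is kept. *)
Lemma beta_err_threshold_le (C : R) (L : int) (e s : R) (T : set (nat -> R)) :
  0 < e -> 1 <= s ->
  (forall eta, T eta -> exists k, e * (threshold C L k + s) < `|eta k|) ->
  beta_err xi e T (threshold_test C L e) <= 2 / s.
Proof.
move=> e0 s1 Ts; have s0 : 0 < s by exact: lt_le_trans s1.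
have tpsi := test_compl (threshold_is_test C L e).
rewrite /beta_err.
have [->|/set0P[eta0 Teta0]] := eqVneq T set0.
  by rewrite image_set0 sup0 divr_ge0// ltW.
apply: ge_sup.
  by exists (Exp xi e eta0 (fun y => 1 - threshold_test C L e y)); exists eta0.
move=> _ [eta Teta <-]; have [k hk] := Ts _ Teta.
apply: (has_mean_le_prob (test_has_mean xi e eta tpsi) (measurable_gt_abs k s)).
  move=> w; rewrite /threshold_test !indicE.
  have [|] := boolP (_ \in [set w0 | s < `|xi k w0|]).
    by move=> _; case: (_ \in _); rewrite ?subr0 ?subrr.
  move=> /negP sw; rewrite (_ : _ \in _ = true) ?subrr//.
  apply/mem_set; exists k; rewrite ltNge; apply/negP => yk; apply: sw.
  apply/mem_set => /=; rewrite /observation in yk.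
  rewrite -(ltr_pM2l e0) -{2}(ger0_norm (ltW e0)) -normrM.
  have := ler_normB (eta k + e * xi k w) (e * xi k w).
  by rewrite addrK; rewrite mulrDr in hk; lra.
apply: le_trans (abs_normal_tail k s0) _.
rewrite lee_fin ler_wpM2l// ler_piMl ?invr_ge0 ?(ltW s0)//.
by rewrite -expR0 ler_expR mulNr oppr_le0 divr_ge0// sqr_ge0.
Qed.

(** Union bound with [t = sqrt (2 ln L)]. Fewer than [L] indices below [L] each cost [2 / (t L)]. An
    index [k >= L] costs at most [(2 / t) k^(- C / 2)], summable as [C > 2]. The final 2 is 1 from
    the first block and 1 from [sum_powRN_le]. *)
Lemma alpha_err_threshold_le (C : R) (L : int) (e : R) : 0 < e -> 2 < C ->
  1 < L%:~R :> R -> 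
  alpha_err xi e (threshold_test C L e) <=
    2 / Num.sqrt (2 * ln L%:~R) * (2 + (C / 2 - 1)^-1).
Proof.
move=> e0 C2 L1; have lnL : 0 < ln L%:~R :> R by rewrite ln_gt0.
have [l Ll] : exists l : nat, L = l%:Z.
  by case: L L1 {lnL} => [l|l]; [exists l|rewrite ltr1z].
rewrite {}Ll -pmulrn in L1 lnL *.
set t := Num.sqrt (2 * ln l%:R).
have t0 : 0 < t by rewrite sqrtr_gt0 mulr_gt0.
pose q := C / 2 - 1.
have q0 : 0 < q by rewrite /q; lra.
pose f (k : nat) : R := 2 / t * ((if (k.+1 < l)%N then l%:R^-1 else 0) +
  k.+1%:R `^ (- (q + 1))).
have f0 k : 0 <= f k.
  apply: mulr_ge0; first by rewrite divr_ge0// ltW.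
  by rewrite addr_ge0 ?powR_ge0//; case: ifP.
have tail k : (P [set w | (threshold C l%:Z k < `|xi k w|)%R] <= (f k)%:E)%E.
  have tE : expR (- t ^+ 2 / 2) = l%:R^-1.
    rewrite sqr_sqrtr ?mulr_ge0 ?(ltW lnL)// mulNr (mulrC 2) mulfK// expRN
      lnK//.
    by rewrite posrE (lt_trans _ L1).
  have it0 : 0 <= 2 / t by rewrite divr_ge0// ltW.
  rewrite /threshold ltz_nat -pmulrn -/t /f; case: ifPn => [kl|].
    apply: le_trans (abs_normal_tail k t0) _.
    by rewrite lee_fin tE mulrA mulrAC ler_wpM2l// lerDl powR_ge0.
  rewrite -leqNgt => lk; rewrite add0r.
  have lnlk : ln l%:R <= ln k.+1%:R :> R.
    by rewrite ler_ln ?posrE ?ltr0n ?ler_nat// -(ltr0n R) (lt_trans _ L1).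
  have lnk : 0 < ln k.+1%:R :> R by exact: lt_le_trans lnlk.
  have C0 : 0 < C by lra.
  have s0 : 0 < Num.sqrt (C * ln k.+1%:R) by rewrite sqrtr_gt0 mulr_gt0.
  apply: le_trans (abs_normal_tail k s0) _.
  rewrite lee_fin -mulrA ler_wpM2l// mulrC ler_pM ?invr_ge0 ?(ltW s0)
    ?expR_ge0//.
    by rewrite lef_pV2 ?posrE// ler_wsqrtr// ler_pM// ltW.
  rewrite sqr_sqrtr ?(ltW (mulr_gt0 C0 lnk))// /powR pnatr_eq0/=.
  by rewrite ler_expR /q le_eqVlt; apply/orP; left; apply/eqP; field.
pose E := \bigcup_k [set w | threshold C l%:Z k < `|xi k w|].
have mE : measurable E by apply: bigcup_measurable => k _;
  exact: measurable_gt_abs.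
apply: (has_mean_le_prob (test_has_mean xi e (fun=>
  0) (threshold_is_test C l%:Z e)) mE).
  move=> w; rewrite /threshold_test !indicE.
  case: (boolP (observation xi e (fun=> 0) w \in _)) => [/set_mem|_];
    last first.
    by case: (_ \in _).
  rewrite /= /observation => -[k]; rewrite add0r normrM (ger0_norm (ltW e0))
    ltr_pM2l// => kw.
  by rewrite (_ : _ \in _ = true)//; apply/mem_set; exists k.
apply: (@le_trans _ _ (\sum_(0 <= k <oo) P [set w | (threshold C l%:Z k < `|xi
  k w|)%R])%E).
  apply: generalized_Boole_inequality => // k; exact: measurable_gt_abs.
apply: (@le_trans _ _ (\sum_(0 <= k <oo) (f k)%:E)%E).
  by apply: lee_nneseries => [k _ _|k _]; [exact: measure_ge0|exact: tail].
apply: (@eseries_le_fin _ _ _ 0%N) => // n _.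
rewrite -mulr_sumr ler_wpM2l ?divr_ge0 ?(ltW t0)// big_split/=.
have := @sum_powRN_le R q n q0.
have : \sum_(i < n) (if (i.+1 < l)%N then l%:R^-1 else 0) <= 1 :> R.
  have l0 : 0 < l%:R :> R by exact: lt_trans L1.
  apply: (@le_trans _ _ ((minn n l)%:R / l%:R)); last first.
    by rewrite ler_pdivrMr// mul1r ler_nat geq_minr.
  elim: n => [|n IH]; first by rewrite big_ord0 divr_ge0// ltW.
  rewrite big_ord_recr/=; apply: (le_trans (lerD IH (lexx _))).
  case: ifPn => nl; last by rewrite addr0 ler_pM2r ?invr_gt0// ler_nat; lia.
  rewrite -[X in _ + X]mul1r -mulrDl ler_pM2r ?invr_gt0// natr1 ler_nat; lia.
rewrite /q; lra.
Qed.

End tails.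

(** * Asymptotics *)

Section asymptotics.
Context {R : realType}.
Implicit Types (kappa : R * R * R) (e x : R) (Sigma : set (R * R * R)).

Lemma log_inv_ge (x : R) : \forall e \near 0^'+, x <= log_inv e.
Proof.
near=> e; have e0 : 0 < e by near: e; exact: nbhs_right_gt.
rewrite /log_inv lnV ?posrE// lerNr -ler_expR lnK ?posrE//.
near: e; apply: nbhs_right_le; exact: expR_gt0.
Unshelve. all: by end_near. Qed.

Lemma loglog_inv_ge (x : R) : \forall e \near 0^'+, x <= loglog_inv e.
Proof.
near=> e; have : expR x <= log_inv e by near: e; exact: log_inv_ge.
move=> h; rewrite /loglog_inv -ler_expR lnK// posrE.
by apply: lt_le_trans h; exact: expR_gt0.
Unshelve. all: by end_near. Qed.

Lemma ln_le_sub1 (x : R) : 0 < x -> ln x <= x - 1.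
Proof.
move=> x0; have := @le_ln1Dx R (x - 1); rewrite addrCA subrr addr0; apply.
lra.
Qed.

(** [ln x = 2 ln (sqrt x) <= 2 sqrt x], which is at most [c x] as soon as [x >= 4 / c^2]. *)
Lemma loglog_inv_le (c : R) : 0 < c ->
  \forall e \near 0^'+, loglog_inv e <= c * log_inv e.
Proof.
move=> c0; near=> e.
have N1 : 1 <= log_inv e by near: e; exact: log_inv_ge.
have Nc : 4 / c ^+ 2 <= log_inv e by near: e; exact: log_inv_ge.
rewrite /loglog_inv; move: N1 Nc; set x := log_inv e => N1 Nc.
have x0 : 0 < x by lra.
have s0 : 0 < Num.sqrt x by rewrite sqrtr_gt0.
rewrite -[x in ln x](sqr_sqrtr (ltW x0)) lnXn// mulr2n.
have := ln_le_sub1 s0.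
have : 2 * Num.sqrt x <= c * x.
  rewrite -[x in c * x](sqr_sqrtr (ltW x0)) expr2 mulrA ler_pM2r//.
  rewrite -ler_pdivrMl// mulrC -ler_sqr ?nnegrE ?divr_ge0 ?(ltW c0)// ?(ltW
    s0)//.
  by rewrite sqr_sqrtr ?(ltW x0)// expr_div_n (_ : 2 ^+ 2 = 4)//; ring.
lra.
Unshelve. all: by end_near. Qed.

Lemma limsup_ratio_lt Sigma (r : R -> R * R * R -> R) (x y : R) : x < y ->
  (limsup_ratio Sigma r (@loglog_inv R) <= x%:E)%E ->
  \forall e \near 0^'+, forall kappa, Sigma kappa ->
    (u_ext e kappa (r e kappa) < (y * loglog_inv e)%:E)%E.
Proof.
move=> xy; rewrite /limsup_ratio limf_esupE => h.
have /ereal_inf_lt[_ [V FV <-] Vy] : (ereal_inf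
    [set ereal_sup [set ereal_sup [set (u_ext e kappa (r e kappa) / (loglog_inv
      e)%:E)%E | kappa in Sigma] | e in V] | V in 0^'+ ] < y%:E)%E.
  by apply: le_lt_trans h _; rewrite lte_fin.
near=> e => kappa Sk.
have l1 : 1 <= loglog_inv e by near: e; exact: loglog_inv_ge.
have Ve : V e by near: e.
have l0 : 0 < loglog_inv e by lra.
rewrite EFinM -lte_pdivrMr//.
apply: le_lt_trans Vy; apply: (@le_trans _ _ (ereal_sup [set (u_ext e kappa (r
  e kappa) / (loglog_inv e)%:E)%E | kappa in Sigma])).
  by apply: ereal_sup_ubound; exists kappa; rewrite // inver gt_eqF.
by apply: ereal_sup_ubound; exists e.
Unshelve. all: by end_near. Qed.

Lemma liminf_ratio_gt Sigma (r : R -> R * R * R -> R) (x : R) :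
  (x%:E < liminf_ratio Sigma r (@loglog_inv R))%E ->
  \forall e \near 0^'+, forall kappa, Sigma kappa ->
    ((x * loglog_inv e)%:E <= u_ext e kappa (r e kappa))%E.
Proof.
rewrite /liminf_ratio limf_einfE => /ereal_sup_gt[_ [V FV <-] Vx].
near=> e => kappa Sk.
have l1 : 1 <= loglog_inv e by near: e; exact: loglog_inv_ge.
have Ve : V e by near: e.
have l0 : 0 < loglog_inv e by lra.
rewrite EFinM -lee_pdivlMr//.
apply: (le_trans (ltW Vx)); apply: (@le_trans _ _ (ereal_inf [set (u_ext e
  kappa (r e kappa) / (loglog_inv e)%:E)%E | kappa in Sigma])).
  by apply: ereal_inf_lbound; exists e.
by apply: ereal_inf_lbound; exists kappa; rewrite // inver gt_eqF.
Unshelve. all: by end_near. Qed.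

Lemma compact_param_bounds Sigma : compact Sigma ->
  (forall kappa, Sigma kappa ->
     [/\ 0 < alpha_of kappa, 0 < beta_of kappa & 0 < q_of kappa <= 2]) ->
  exists b0 b1 a1 : R, [/\ 0 < b0, b0 <= b1, 0 < a1 & forall kappa, Sigma kappa
    ->
    b0 <= beta_of kappa <= b1 /\ alpha_of kappa <= a1].
Proof.
move=> cS Spos; have [S0|S0] := eqVneq Sigma set0.
  by exists 1, 1, 1; split => // kappa; rewrite S0.
have S0' : Sigma !=set0 by exact/set0P.
have cb : continuous (@beta_of R).
  by move=> k; apply: (@continuous_comp _ _ _ fst snd);
    [exact: cvg_fst|exact: cvg_snd].
have ca : continuous (@alpha_of R).
  by move=> k; apply: (@continuous_comp _ _ _ fst fst);
    [exact: cvg_fst|exact: cvg_fst].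
have [kb /set_mem Skb hkb] := compact_EVT_min S0' cS (continuous_subspaceT cb).
have [kB /set_mem SkB hkB] := compact_EVT_max S0' cS (continuous_subspaceT cb).
have [kA /set_mem SkA hkA] := compact_EVT_max S0' cS (continuous_subspaceT ca).
exists (beta_of kb), (beta_of kB), (alpha_of kA); split.
- by have [] := Spos _ Skb.
- by apply: hkB; exact/mem_set.
- by have [] := Spos _ SkA.
- move=> k /mem_set Sk; split; last exact: hkA.
  by rewrite hkb// hkB.
Qed.

(** Used with [x = r^(- 1 / alpha)], the real index where [a_k r = 1]. Since argument [m] stands for
    index [m + 1], the last two clauses read [a_m r <= 1 <= a_(m+1) r]. *)
Lemma round_radius (al x : R) : 0 < al -> 1 <= x ->
  exists m : nat, [/\ m.+1%:R <= x, x <= m.+1%:R + 1,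
    m.+1%:R `^ al * x `^ (- al) <= 1 & 1 <= m.+2%:R `^ al * x `^ (- al)].
Proof.
move=> al0 x1; have x0 : 0 < x by lra.
have := truncn_itv (ltW x0).
case E : (Num.truncn x) => [|m].
  by rewrite ltNge x1 andbF.
move=> /andP[mx xm]; exists m; split => //; first by rewrite natr1 ltW.
- rewrite powRN ler_pdivrMr ?powR_gt0// mul1r.
  by rewrite ge0_ler_powR ?nnegrE ?(ltW al0) ?(ltW x0).
- rewrite powRN ler_pdivlMr ?powR_gt0// mul1r.
  by rewrite ge0_ler_powR ?nnegrE ?(ltW al0) ?(ltW x0)// ltW.
Qed.

End asymptotics.

Section extremal_bounds.
Context {R : realType}.
Implicit Types (kappa : R * R * R) (eta : nat -> R) (e r x : R).

(** As [a_k >= 1], the ellipsoid constraint bounds the total energy by 1. *)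
Lemma Theta_radius_le1 kappa r eta : 0 < alpha_of kappa ->
  0 < q_of kappa <= 2 -> 0 < r -> Theta kappa r eta -> r <= 1.
Proof.
move=> al0 q02 r0 [_ Hq Hr].
rewrite -(@ler_pXn2r _ 2) ?nnegrE ?(ltW r0)// expr1n -lee_fin.
apply: (le_trans Hr); apply: (@eseries_le_fin _ _ _ 0%N) => [k|n _].
  by rewrite mulr_ge0 ?sqr_ge0.
apply: le_trans (sum_sqr_le_ellipsoid n q02 Hq); apply: ler_sum => k _.
rewrite -exprMn -mulrA (exprMn _ (a_seq kappa k)) ler_peMl ?sqr_ge0//.
by rewrite exprn_ege1// -[leLHS](powRr0 k.+1%:R) ler_powR ?ler1n// ltW.
Qed.

Lemma sigma_seqS kappa (m : nat) :
  sigma_seq kappa m.+1 = expR (beta_of kappa) * sigma_seq kappa m.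
Proof. by rewrite /sigma_seq -expRD -natr1; congr expR; ring. Qed.

Lemma u_ext_le_radius kappa (m : nat) e r : 0 < q_of kappa -> 0 < e -> 0 < r ->
  a_seq kappa m * r <= 1 ->
  (u_ext e kappa r <= ((r / sigma_seq kappa m) ^+ 2 / e ^+ 2)%:E)%E.
Proof.
move=> q0 e0 r0 am; have s0 := sigma_seq_gt0 kappa m.
have v0 : 0 <= r / sigma_seq kappa m by rewrite divr_ge0// ltW.
apply: u_ext_spike => //; apply: (@spike_Theta _ kappa m _ _ q0 v0 (ltW r0)).
  by rewrite mulrA mulrAC mulfK ?gt_eqF.
by rewrite mulrC divfK// gt_eqF.
Qed.

(** The spike at the rounded index [m] gives [Y e^2 sigma_m^2 <= r^2], with [Y] the assumed lower
    bound on [u]. Were all coordinates up to [m + 1] small, [ellipsoid_head] at [m + 1] would bound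
    [r^2] by half of this: [exp (2 b1)] pays for the rounding, 2 for strictness. The position bound
    comes from [r <= 1] and [Y >= 1], whence [e sigma_m <= 1]. *)
Lemma large_coordinate kappa (b0 b1 e r x D : R) eta :
  0 < alpha_of kappa -> 0 < b0 -> b0 <= beta_of kappa <= b1 ->
  0 < q_of kappa <= 2 -> 0 < e -> 0 < r -> 0 < x -> 0 < D ->
  1 <= 2 * D * spread_cst b0 * expR (2 * b1) * x ->
  ((2 * D * spread_cst b0 * expR (2 * b1) * x)%:E <= u_ext e kappa r)%E ->
  Theta kappa r eta ->
  exists k, D * x * e ^+ 2 < eta k ^+ 2 /\ k.+1%:R <= log_inv e / b0 + 1.
Proof.
move=> al0 b00 /andP[bb0 bb1] q02 e0 r0 x0 D0 D1 Du Teta.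
have K0 := spread_cst_gt0 b00.
have r1 := Theta_radius_le1 al0 q02 r0 Teta.
pose y := r^-1 `^ (alpha_of kappa)^-1.
have y1 : 1 <= y.
  rewrite -[leLHS](powRr0 r^-1) ler_powR ?invr_ge0 ?(ltW al0)//.
  by rewrite invf_ge1.
have ry : y `^ (- alpha_of kappa) = r.
  rewrite powRN /y -powRrM mulVf ?gt_eqF// powRr1 ?invr_ge0 ?(ltW r0)//.
  by rewrite invrK.
have [m [_ _ am1 am2]] := round_radius al0 y1.
rewrite ry in am1 am2.
have s0 := sigma_seq_gt0 kappa m.
have q0 : 0 < q_of kappa by case/andP: q02.
have := le_trans Du (u_ext_le_radius q0 e0 r0 am1).
rewrite lee_fin ler_pdivlMr ?exprn_gt0// expr_div_n ler_pdivlMr ?exprn_gt0//.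
set Y := _ * x => YX.
have e2 : 0 < e ^+ 2 by rewrite exprn_gt0.
have [//|H] := pselect (exists k, D * x * e ^+ 2 < eta k ^+ 2 /\
  k.+1%:R <= log_inv e / b0 + 1).
exfalso.
have mN : m.+1%:R <= log_inv e / b0.
  have es : e * sigma_seq kappa m <= 1.
    rewrite -(@ler_pXn2r _ 2) ?nnegrE ?mulr_ge0 ?(ltW e0) ?(ltW s0)//.
    rewrite expr1n exprMn; apply: (@le_trans _ _ (r ^+ 2)).
      apply: le_trans YX; rewrite -mulrA ler_peMl//.
      by rewrite mulr_ge0 ?sqr_ge0.
    by rewrite exprn_ile1// ltW.
  rewrite ler_pdivlMr// mulrC (@le_trans _ _ (beta_of kappa * m.+1%:R))//.
    by rewrite ler_wpM2r.
  move: es; rewrite -ler_ln ?posrE ?mulr_gt0// ln1 lnM ?posrE//.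
  by rewrite /log_inv lnV ?posrE// /sigma_seq expRK; lra.
have := @ellipsoid_head _ kappa eta b0 (D * x * e ^+ 2) r m.+1 al0 b00 bb0 q02
  r0 am2 Teta.
have Hk k : (k <= m.+1)%N -> eta k ^+ 2 <= D * x * e ^+ 2.
  move=> km; rewrite leNgt; apply/negP => lt; apply: H; exists k; split => //.
  apply: le_trans (lerD mN (lexx 1)); rewrite natr1 ler_nat.
  by rewrite ltnS.
move=> /(_ Hk); apply/negP; rewrite -ltNge (lt_le_trans _ YX)//.
rewrite sigma_seqS exprMn -expRM_natl.
have E : expR (2 * beta_of kappa) <= expR (2 * b1) by rewrite ler_expR ler_pM2l.
apply: (@le_lt_trans _ _ (D * x * e ^+ 2 * spread_cst b0 *
    (expR (2 * b1) * sigma_seq kappa m ^+ 2))).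
  rewrite ler_wpM2l//; last by rewrite ler_wpM2r ?sqr_ge0.
  by rewrite !mulr_ge0 ?(ltW x0) ?(ltW D0) ?(ltW e0) ?(ltW K0).
rewrite [ltRHS](_ : _ = 2 * (D * x * e ^+ 2 * spread_cst b0 *
    (expR (2 * b1) * sigma_seq kappa m ^+ 2))); last by rewrite /Y; ring.
rewrite ltr_pMl ?ltr1n//.
by rewrite !mulr_gt0// ?expR_gt0// exprn_gt0.
Qed.

Lemma threshold_le (C : R) (L : int) (k : nat) (x : R) : 1 <= C -> 0 < L%:~R :>
  R ->
  L%:~R <= x -> ln k.+1%:R <= 2 * x -> threshold C L k <= Num.sqrt (2 * C * x).
Proof.
move=> C1 L0 Lx kx; have x0 : 0 < x by exact: lt_le_trans Lx.
rewrite /threshold; case: ifP => _; rewrite ler_wsqrtr//.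
  have := ln_le_sub1 L0; have : x <= C * x by rewrite ler_peMl// ltW.
  lra.
by rewrite [2 * C]mulrC -mulrA ler_wpM2l//; lra.
Qed.

(** [4 C + 2] comes from [(s + t)^2 <= 2 s^2 + 2 t^2] with [s^2 = 2 C x] and [t^2 = x]. *)
Lemma threshold_gap (C : R) (L : int) (k : nat) (e x v : R) : 1 <= C -> 0 < e ->
  0 < L%:~R :> R -> L%:~R <= x -> ln k.+1%:R <= 2 * x ->
  (4 * C + 2) * x * e ^+ 2 < v ^+ 2 ->
  e * (threshold C L k + Num.sqrt x) < `|v|.
Proof.
move=> C1 e0 L0 Lx kx xv; have x0 : 0 < x by exact: lt_le_trans Lx.
have H := threshold_le C1 L0 Lx kx.
apply: (@le_lt_trans _ _ (e * (Num.sqrt (2 * C * x) + Num.sqrt x))).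
  by rewrite ler_pM2l// lerD2r.
rewrite -ltr_sqr ?nnegrE//; last by rewrite mulr_ge0 ?(ltW e0)// addr_ge0.
rewrite real_normK ?num_real// (le_lt_trans _ xv)// exprMn mulrC ler_wpM2r
  ?sqr_ge0//.
have Cx0 : 0 <= 2 * C * x by rewrite !mulr_ge0 ?(ltW x0)//; lra.
have := sqr_sqrtr Cx0; have := sqr_sqrtr (ltW x0).
have := sqr_ge0 (Num.sqrt (2 * C * x) - Num.sqrt x).
move: (Num.sqrt (2 * C * x)) (Num.sqrt x) => s t.
nra.
Qed.

End extremal_bounds.

(** * Lower bound: spikes inside the alternative *)

Section lower_bound.
Context {R : realType} {d : measure_display} {Omega : measurableType d}
  {P : probability Omega R}.
Variables (xi : nat -> {RV P >-> R}) (hxi : iid_std_normal xi).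
Implicit Types (Sigma : set (R * R * R)) (T : set (nat -> R)).

Lemma is_test0 : is_test (fun=> 0 : R).
Proof. by split => // y; rewrite lexx ler01. Qed.

Lemma alpha_err0 (e : R) : alpha_err xi e (fun=> 0) = 0.
Proof.
have [_ _] := test_has_mean xi e (fun=> 0) is_test0.
by rewrite integral0 /alpha_err => -[<-].
Qed.

Lemma err_ge0 (e : R) T psi : is_test psi ->
  0 <= alpha_err xi e psi + beta_err xi e T psi.
Proof.
move=> tpsi; rewrite addr_ge0//; last exact: beta_err_ge0.
by have /andP[] := Exp_test_itv xi e (fun=> 0) tpsi.
Qed.

Lemma gamma_err_le (e : R) T psi : is_test psi ->
  gamma_err xi e T <= alpha_err xi e psi + beta_err xi e T psi.
Proof.
move=> tpsi; apply: ge_inf; last by exists psi.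
by exists 0 => _ [psi' tpsi' <-]; exact: err_ge0.
Qed.

Lemma gamma_err_ge (e x : R) T :
  (forall psi, is_test psi -> x <= alpha_err xi e psi + beta_err xi e T psi) ->
  x <= gamma_err xi e T.
Proof.
move=> h; apply: lb_le_inf.
  by eexists; exists (fun=> 0) => //; exact: is_test0.
by move=> _ [psi tpsi <-]; exact: h.
Qed.

Lemma gamma_err_le1 (e : R) T : gamma_err xi e T <= 1.
Proof.
apply: le_trans (gamma_err_le e T is_test0) _.
by rewrite alpha_err0 add0r; exact: (beta_err_le1 xi e T is_test0).
Qed.

Lemma gamma_err_ge0 (e : R) T : 0 <= gamma_err xi e T.
Proof. by apply: gamma_err_ge => psi; exact: err_ge0. Qed.

(* The last hypothesis, that the spike lies on the boundary of the ellipsoid, is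
   met by tuning beta to the position [m]. *)
Lemma spike_in_alternative (kappa : R * R * R) (b0 e r x B : R) (m : nat) :
  0 < alpha_of kappa -> 0 < b0 -> b0 <= beta_of kappa -> 0 < q_of kappa <= 2 ->
  0 < e -> 0 < r -> 0 < x -> 0 < B -> 2 * x * spread_cst b0 = B ^+ 2 ->
  (u_ext e kappa r < x%:E)%E ->
  a_seq kappa m * sigma_seq kappa m * (e * B) = 1 ->
  Theta kappa r (fun k => (e * B) *+ (k == m)).
Proof.
move=> al0 b00 bb q02 e0 r0 x0 B0 xB ux am.
have s0 := sigma_seq_gt0 kappa m.
apply: spike_Theta; rewrite ?am//.
- by case/andP: q02.
- by rewrite mulr_ge0 ?ltW.
- exact: ltW.
(* If [r > sigma_m e B], the boundary condition gives [a_m r >= 1]. Then [ellipsoid_head], applied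
   to a member with all squares at most [2 x e^2], yields [r <= sigma_m e B]. *)
rewrite leNgt; apply/negP => lt.
have am1 : 1 <= a_seq kappa m * r.
  by rewrite -am -mulrA ler_wpM2l// ltW// a_seq_gt0.
have [eta Teta eta_le] := u_ext_lt e0 (ltW x0) ux.
have := @ellipsoid_head _ kappa eta b0 (2 * x * e ^+ 2) r m al0 b00 bb q02 r0
  am1 Teta.
move=> /(_ (fun k _ => eta_le k)); apply/negP; rewrite -ltNge.
rewrite (_ : _ * _ = (sigma_seq kappa m * (e * B)) ^+ 2).
  by rewrite ltr_pXn2r// nnegrE ?mulr_ge0 ?(ltW s0) ?(ltW e0) ?(ltW B0) ?(ltW
    r0).
by rewrite !exprMn -xB; ring.
Qed.

(** Positions stop at [(2 a + 2 c) N = (3 a + b) N / 2], short of [2 b N]. There [x / (2 b)] is at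
    most [N - 3 (b - a) / (4 b) N], which leaves room for the lower-order terms
    [y + al z <= (1 + 2 al) l]. *)
Lemma spike_exponent_range (a b al c N l y z x : R) :
  0 < a -> a < b -> 0 < al -> c = (b - a) / 4 ->
  l <= 3 * (b - a) / (4 * b) / (1 + 2 * al) * N ->
  0 <= y -> y <= l -> 0 <= z -> z <= 2 * l ->
  0 < x -> 2 * a * N <= x -> x <= (2 * a + 2 * c) * N ->
  (2 * b)^-1 <= (N - y - al * z) / x <= (2 * a)^-1.
Proof.
move=> a0 ab al0 cE lN y0 yl z0 zl x0 xlo xhi.
have b0 : 0 < b by exact: lt_trans ab.
have az0 : 0 <= al * z by rewrite mulr_ge0// ltW.
have azl : al * z <= al * (2 * l) by rewrite ler_pM2l.
apply/andP; split.
- rewrite ler_pdivlMr// ler_pdivrMl ?mulr_gt0//.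
  move: lN; rewrite mulrAC ler_pdivlMr ?addr_gt0 ?mulr_gt0//.
  rewrite mulrAC ler_pdivlMr ?mulr_gt0// => lN.
  have : 4 * b * (y + al * z) <= 4 * b * (l + al * (2 * l)).
    by rewrite ler_pM2l ?mulr_gt0// lerD.
  move: xhi lN; rewrite cE; clear; lra.
- rewrite ler_pdivrMr// ler_pdivlMl ?mulr_gt0//; apply: le_trans xlo.
  by rewrite ler_pM2l ?mulr_gt0// lerBlDr lerBlDr; move: y0 az0; clear; lra.
Qed.

Lemma expR_half_div_le (l k s : R) : 0 < k -> 0 < s -> 2 / s <= l ->
  expR l <= k -> expR (l / 2) / k <= s.
Proof.
move=> k0 s0 sl lk; rewrite ler_pdivrMr//.
apply: (@le_trans _ _ (s * expR l)); last by rewrite ler_pM2l.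
have -> : expR l = expR (l / 2) * expR (l / 2).
  by rewrite -expRD; congr expR; field.
rewrite mulrA ler_peMl ?expR_ge0// -ler_pdivrMl// mulr1.
apply: le_trans (expR_ge1Dx _); move: sl; rewrite [2 / s]mulrC; lra.
Qed.

Lemma lower_bound Sigma :
  (forall kappa, Sigma kappa ->
     [/\ 0 < alpha_of kappa, 0 < beta_of kappa & 0 < q_of kappa <= 2]) ->
  contains_beta_interval Sigma ->
  exists d0 : R, 0 < d0 /\
    forall r : R -> R * R * R -> R, radii Sigma r ->
      (limsup_ratio Sigma r (@loglog_inv R) <= d0%:E)%E ->
      gamma_err xi e (Theta_union Sigma (r e)) @[e --> 0^'+] --> (1 : R).
Proof.
move=> Spos [a [b [al [a0 ab al0 Hsub]]]].
have b0 : 0 < b by lra.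
pose b' := (2 * b)^-1.
have b'0 : 0 < b' by rewrite invr_gt0 mulr_gt0.
pose K := spread_cst b'; have K0 : 0 < K by exact: spread_cst_gt0.
(* The spikes need [u < l / (4 K)], so that [2 x K = l / 2 = B^2] with [x = l / (4 K)]; halving the
   constant turns a non-strict limsup bound into a strict eventual one. *)
exists (8 * K)^-1; split; first by rewrite invr_gt0 mulr_gt0.
move=> r [r0 _] hlim.
have hu : \forall e \near 0^'+, forall kappa, Sigma kappa ->
    (u_ext e kappa (r e kappa) < ((4 * K)^-1 * loglog_inv e)%:E)%E.
  apply: limsup_ratio_lt hlim.
  by rewrite ltf_pV2 ?posrE ?mulr_gt0// ltr_pM2r// ltr_nat.
apply/cvgrPdist_le => dl dl0.
have [c cE c0] : exists2 c : R, c = (b - a) / 4 & 0 < c.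
  by eexists; [reflexivity|rewrite divr_gt0 ?subr_gt0].
near=> e.
have e0 : 0 < e by near: e; exact: nbhs_right_gt.
have ue : forall kappa, Sigma kappa ->
    (u_ext e kappa (r e kappa) < ((4 * K)^-1 * loglog_inv e)%:E)%E.
  by near: e.
have N1 : 1 <= log_inv e by near: e; exact: log_inv_ge.
have N2 : (a + b) * 2 <= log_inv e by near: e; exact: log_inv_ge.
have N3 : 2 / c <= log_inv e by near: e; exact: log_inv_ge.
have l2 : 2 <= loglog_inv e by near: e; exact: loglog_inv_ge.
have ld : 2 / (dl ^+ 2 * c) <= loglog_inv e by near: e; exact: loglog_inv_ge.
have lN : loglog_inv e <= 3 * (b - a) / (4 * b) / (1 + 2 * al) * log_inv e.
  near: e; apply: loglog_inv_le.
  by rewrite !divr_gt0 ?mulr_gt0 ?subr_gt0// addr_gt0// mulr_gt0.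
have Nl : log_inv e = expR (loglog_inv e) by rewrite lnK// posrE; lra.
set N := log_inv e in N1 N2 N3 lN Nl *.
set l := loglog_inv e in l2 ld lN Nl ue *.
have N0 : 0 < N by lra.
pose B := Num.sqrt (l / 2).
have B2 : B ^+ 2 = l / 2 by rewrite sqr_sqrtr//; lra.
have B1 : 1 <= B by rewrite -[leLHS]sqrtr1 ler_wsqrtr//; lra.
have B0 : 0 < B by lra.
have lnB0 : 0 <= ln B by rewrite ln_ge0.
have lnBl : ln B <= l.
  have := ln_le_sub1 B0; have : B <= B ^+ 2 by rewrite expr2 ler_peMl// ltW.
  by rewrite B2; lra.
rewrite ger0_norm ?subr_ge0 ?gamma_err_le1// lerBlDl -lerBlDr.
apply: gamma_err_ge => psi tpsi.
pose m := Num.truncn (2 * a * N); pose n := Num.truncn (2 * c * N).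
have mN : m%:R <= 2 * a * N < m.+1%:R.
  by apply: truncn_itv; rewrite !mulr_ge0 ?(ltW a0) ?(ltW N0).
have nN : n%:R <= 2 * c * N < n.+1%:R.
  by apply: truncn_itv; rewrite mulr_ge0 ?(ltW N0)// mulr_ge0// ltW.
move/andP: mN => [mN1 mN2]; move/andP: nN => [nN1 nN2].
have ncN : c * N <= n%:R.
  rewrite -natr1 in nN2; have : 2 <= c * N by rewrite -ler_pdivrMl// mulrC.
  lra.
have n0 : (0 < n)%N by rewrite -(ltr_nat R) (lt_le_trans _ ncN)// mulr_gt0.
apply: (@bayes_risk_ge _ _ _ _ xi hxi e B dl m n) => //.
  (* As [n >= c N] and [N = exp l], the excess second moment is at most [exp (- l / 2) / c]. *)
  rewrite B2; apply: (@le_trans _ _ (c^-1 * (expR (l / 2) / N))).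
    by rewrite mulrCA -invfM ler_wpM2l ?expR_ge0// lef_pV2 ?posrE ?mulr_gt0
      ?ltr0n.
  rewrite ler_pdivrMl//; apply: expR_half_div_le; rewrite // ?Nl//.
    by rewrite mulr_gt0// exprn_gt0.
  by rewrite [c * _]mulrC.
move=> i ni.
pose x : R := (m + i).+1%:R.
have x1 : 1 <= x by rewrite ler1n.
have x0 : 0 < x by lra.
have xlo : 2 * a * N <= x.
  by apply: (le_trans (ltW mN2)); rewrite ler_nat ltnS leq_addr.
have xhi : x <= (2 * a + 2 * c) * N.
  rewrite mulrDl; apply: le_trans (lerD mN1 nN1).
  by rewrite -natrD ler_nat -addnS leq_add2l.
have lnx0 : 0 <= ln x by rewrite ln_ge0.
have lnx : ln x <= 2 * l.
  have h : x <= N ^+ 2.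
    by apply: (le_trans xhi); rewrite expr2 ler_wpM2r ?(ltW N0)//; lra.
  have -> : 2 * l = ln (N ^+ 2) by rewrite lnXn// mulr2n mulrDl mul1r.
  by rewrite ler_ln ?posrE ?exprn_gt0.
(* The solution of [a_m sigma_m e B = 1] in beta at position [x]. *)
pose be := (N - ln B - al * ln x) / x.
have be_range : (2 * b)^-1 <= be <= (2 * a)^-1.
  exact: (spike_exponent_range a0 ab al0 cE lN lnB0 lnBl lnx0 lnx x0 xlo xhi).
have [q Sq] := Hsub be be_range.
exists (al, be, q) => //.
have [_ be0 q02] := Spos _ Sq.
have be_lo : b' <= be by case/andP: be_range.
apply: (@spike_in_alternative _ b' _ _ ((4 * K)^-1 * l)) => //.
- exact: r0.
- by rewrite mulr_gt0 ?invr_gt0 ?mulr_gt0//; lra.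
- by rewrite B2 -/K; field; rewrite gt_eqF.
- exact: ue.
rewrite /a_seq /sigma_seq /alpha_of /beta_of /= -/x /powR gt_eqF//.
rewrite -[e]lnK ?posrE// -[X in _ * (_ * X)]lnK ?posrE// -!expRD.
rewrite (_ : _ + _ = 0) ?expR0// /be divfK ?gt_eqF//.
by rewrite /N /log_inv lnV ?posrE//; ring.
Unshelve. all: by end_near. Qed.

End lower_bound.

(** * Upper bound: both errors of the threshold test vanish *)

Section upper_bound.
Context {R : realType} {d : measure_display} {Omega : measurableType d}
  {P : probability Omega R}.
Variables (xi : nat -> {RV P >-> R}) (hxi : iid_std_normal xi).
Implicit Types (Sigma : set (R * R * R)) (T : set (nat -> R)).

Lemma admissible_cutoff_ge (L : R -> int) (x : R) : admissible_cutoff L ->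
  \forall e \near 0^'+, x <= (L e)%:~R.
Proof. by move=> [/cvgryPge Ly _]; exact: Ly. Qed.

Lemma admissible_cutoff_le (L : R -> int) : admissible_cutoff L ->
  \forall e \near 0^'+, (L e)%:~R <= loglog_inv e.
Proof.
move=> [_ /cvgrPdist_le/(_ 1 ltr01) L0]; near=> e.
have l0 : 1 <= loglog_inv e by near: e; exact: loglog_inv_ge.
have : `|0 - (L e)%:~R / loglog_inv e| <= 1 by near: e.
rewrite sub0r normrN => /(le_trans (ler_norm _)).
by rewrite ler_pdivrMr ?mul1r//; lra.
Unshelve. all: by end_near. Qed.

Lemma alpha_err_threshold_cvg (C : R) (L : R -> int) : 2 < C ->
  admissible_cutoff L ->
  alpha_err xi e (threshold_test C (L e) e) @[e --> 0^'+] --> (0 : R).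
Proof.
move=> C2 HL; apply/cvgrPdist_le => dl dl0.
pose K := 2 + (C / 2 - 1)^-1.
have K0 : 0 < K by rewrite addr_gt0// invr_gt0; lra.
near=> e; have e0 : 0 < e by near: e; exact: nbhs_right_gt.
have L2 : 2 <= (L e)%:~R :> R by near: e; exact: admissible_cutoff_ge.
have Lx : expR ((2 * K / dl) ^+ 2 / 2) <= (L e)%:~R :> R.
  by near: e; exact: admissible_cutoff_ge.
have /andP[al0 _] := Exp_test_itv xi e (fun=> 0) (threshold_is_test C (L e) e).
rewrite sub0r normrN ger0_norm//.
apply: le_trans (alpha_err_threshold_le hxi e0 C2 _) _; first by lra.
rewrite -/K; set t := Num.sqrt _.
have lnL : (2 * K / dl) ^+ 2 / 2 <= ln (L e)%:~R.
  by rewrite -ler_expR lnK// posrE; lra.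
have kd0 : 0 < 2 * K / dl by rewrite divr_gt0// mulr_gt0.
have ht : 2 * K / dl <= t.
  rewrite -[leLHS]ger0_norm ?(ltW kd0)// -sqrtr_sqr ler_wsqrtr//.
  by lra.
rewrite mulrAC ler_pdivrMr ?(lt_le_trans kd0 ht)//.
by rewrite (mulrC dl) -ler_pdivrMr.
Unshelve. all: by end_near. Qed.

Lemma beta_err_threshold_cvg (C : R) Sigma : 2 < C -> compact Sigma ->
  (forall kappa, Sigma kappa ->
     [/\ 0 < alpha_of kappa, 0 < beta_of kappa & 0 < q_of kappa <= 2]) ->
  exists D0 : R, 0 < D0 /\
    forall (L : R -> int) (r : R -> R * R * R -> R),
      admissible_cutoff L -> radii Sigma r ->
      (D0%:E < liminf_ratio Sigma r (@loglog_inv R))%E ->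
      beta_err xi e (Theta_union Sigma (r e)) (threshold_test C (L e) e)
        @[e --> 0^'+] --> (0 : R).
Proof.
move=> C2 cS Spos; have [b0 [b1 [a1 [b00 b01 a10 Sb]]]] := compact_param_bounds
  cS Spos.
pose D := 4 * C + 2.
have D0 : 0 < D by rewrite /D; lra.
(* [D] is what [threshold_gap] demands of a squared coordinate, and the other factors are the loss
   in [large_coordinate]. *)
pose D1 := 2 * D * spread_cst b0 * expR (2 * b1).
have D10 : 0 < D1 by rewrite !mulr_gt0 ?expR_gt0 ?spread_cst_gt0.
exists D1; split=> // L r HL [r0 _] hlim.
have hu := liminf_ratio_gt hlim.
apply/cvgrPdist_le => dl dl0; near=> e.
have e0 : 0 < e by near: e; exact: nbhs_right_gt.
have ue : forall kappa, Sigma kappa ->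
    ((D1 * loglog_inv e)%:E <= u_ext e kappa (r e kappa))%E by near: e.
have N1 : 1 <= log_inv e by near: e; exact: log_inv_ge.
have N2 : b0^-1 + 1 <= log_inv e by near: e; exact: log_inv_ge.
have l1 : 1 <= loglog_inv e by near: e; exact: loglog_inv_ge.
have l2 : D1^-1 <= loglog_inv e by near: e; exact: loglog_inv_ge.
have l3 : (2 / dl) ^+ 2 <= loglog_inv e by near: e; exact: loglog_inv_ge.
have L0 : 1 <= (L e)%:~R :> R by near: e; exact: admissible_cutoff_ge.
have Ll : (L e)%:~R <= loglog_inv e by near: e; exact: admissible_cutoff_le.
have l0 : 0 < loglog_inv e by lra.
rewrite sub0r normrN ger0_norm; last exact/beta_err_ge0/threshold_is_test.
apply: (@le_trans _ _ (2 / Num.sqrt (loglog_inv e))).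
  apply: beta_err_threshold_le => //.
    by rewrite -[leLHS]sqrtr1 ler_wsqrtr.
  move=> eta [kappa Sk Teta].
  have [al0 _ q02] := Spos _ Sk; have [bb _] := Sb _ Sk.
  have [||k [kD kN]] := @large_coordinate _ kappa b0 b1 e (r e kappa)
      (loglog_inv e) D eta al0 b00 bb q02 e0 (r0 _ _ e0 Sk) l0 D0 _ _ Teta.
  - by rewrite -/D1 mulrC -ler_pdivrMr// div1r.
  - exact: ue.
  exists k; apply: threshold_gap => //; try lra.
  (* The large coordinate has index at most [log (1/e) / b0 + 1], eventually below [log (1/e)^2]. *)
  have -> : 2 * loglog_inv e = ln (log_inv e ^+ 2).
    by rewrite lnXn ?mulr2n ?mulrDl ?mul1r//; lra.
  have N0 : 0 < log_inv e by lra.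
  rewrite ler_ln ?posrE ?exprn_gt0//; apply: (le_trans kN).
  rewrite expr2; have : 1 <= log_inv e * 1 by lra.
  have : log_inv e * (b0^-1 + 1) <= log_inv e * log_inv e by rewrite ler_pM2l.
  by lra.
have d0 : 0 < 2 / dl by rewrite divr_gt0.
have : 2 / dl <= Num.sqrt (loglog_inv e).
  by rewrite -[leLHS]ger0_norm ?(ltW d0)// -sqrtr_sqr ler_wsqrtr.
move=> h; rewrite ler_pdivrMr ?(lt_le_trans d0 h)//.
by rewrite (mulrC dl) -ler_pdivrMr.
Unshelve. all: by end_near. Qed.

End upper_bound.

(** * Separation rates *)

Section separation_rates.
Context {R : realType}.
Implicit Types (kappa : R * R * R) (e : R) (Sigma : set (R * R * R)).

(** The real index [x] where [a_x r_ad = 1]. It solves [l (e sigma_x)^2 = log (1/e)^(- 2 alpha)];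
    since [x] is comparable to [log (1/e)], the right side is [r_ad^2] up to constants. *)
Definition radius_level e kappa : R :=
  (2 * log_inv e - 2 * alpha_of kappa * loglog_inv e - logloglog_inv e)
    / (2 * beta_of kappa).

Lemma radius_levelE e kappa : 0 < beta_of kappa ->
  2 * beta_of kappa * radius_level e kappa =
  2 * log_inv e - 2 * alpha_of kappa * loglog_inv e - logloglog_inv e.
Proof.
by move=> be0; rewrite /radius_level mulrC divfK// gt_eqF// mulr_gt0.
Qed.

Lemma r_adE e kappa : 0 < radius_level e kappa ->
  r_ad e kappa = radius_level e kappa `^ (- alpha_of kappa).
Proof.
move=> x0; rewrite /r_ad -invf_div -/(radius_level e kappa).
by rewrite -powR_inv1 ?(ltW x0)// -powRrM mulN1r.
Qed.

Lemma radius_level_bounds (b0 b1 a1 e : R) kappa :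
  0 < b0 -> b0 <= beta_of kappa <= b1 -> 0 < alpha_of kappa <= a1 ->
  1 <= loglog_inv e -> (2 * a1 + 1) * loglog_inv e <= log_inv e ->
  2 * b1 <= log_inv e ->
  [/\ 1 <= radius_level e kappa,
      loglog_inv e <= ln (radius_level e kappa) + 2 * b1 &
      ln (radius_level e kappa) <= loglog_inv e + b0^-1].
Proof.
move=> b00 /andP[bb0 bb1] /andP[al0 al1] l1 lN bN.
have N0 : 0 < log_inv e.
  (* [ln] is 0 on nonpositive arguments, which contradicts [1 <= loglog_inv e]. *)
  have [//|N0] := ltP 0 (log_inv e).
  by move: l1; rewrite /loglog_inv ln0// ler10.
have l0 : 0 < loglog_inv e by lra.
have ll0 : 0 <= logloglog_inv e by rewrite ln_ge0.
have ll1 : logloglog_inv e <= loglog_inv e by have := ln_le_sub1 l0;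
  rewrite /logloglog_inv; lra.
have al : alpha_of kappa * loglog_inv e <= a1 * loglog_inv e by rewrite
  ler_pM2r.
have al' : 0 <= alpha_of kappa * loglog_inv e by rewrite mulr_ge0 ?ltW.
have be0 : 0 < beta_of kappa by lra.
have := radius_levelE e be0.
move: (radius_level e kappa) => x xE.
have x1 : 1 <= x.
  have : 2 * beta_of kappa * 1 <= 2 * beta_of kappa * x by rewrite xE; lra.
  by rewrite ler_pM2l ?mulr_gt0.
have x0 : 0 < x by lra.
split => //.
- rewrite -[2 * b1]expRK -lnM ?posrE ?expR_gt0// /loglog_inv ler_ln ?posrE
  ?mulr_gt0 ?expR_gt0//.
  have : x * (2 * b1) <= x * expR (2 * b1).
    by rewrite ler_wpM2l ?(ltW x0)//; have := expR_ge1Dx (2 * b1); lra.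
  have : x * beta_of kappa <= x * b1 by rewrite ler_pM2l.
  lra.
- rewrite -[b0^-1]expRK -lnM ?posrE ?expR_gt0// /loglog_inv ler_ln ?posrE
  ?mulr_gt0 ?expR_gt0//.
  have : log_inv e * b0^-1 <= log_inv e * expR b0^-1.
    by rewrite ler_pM2l//; have := expR_ge1Dx b0^-1; lra.
  apply: le_trans; rewrite ler_pdivlMr//.
  have : x * b0 <= x * beta_of kappa by rewrite ler_pM2l.
  lra.
Qed.

(** All quantities are written as exponentials and exponents compared: [alpha (ln x - l)] is bounded
    on both sides and rounding [x] changes [beta x] by at most [b1]. The spike at [m] gives the
    upper bound, [ellipsoid_head] at [m + 1] the lower one. The 6 is the 3 of [u_ext_ge] times 2 for
    strictness. *)
Lemma u_ext_r_ad_bounds (b0 b1 a1 e : R) kappa :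
  0 < b0 -> b0 <= beta_of kappa <= b1 -> 0 < alpha_of kappa <= a1 ->
  0 < q_of kappa <= 2 -> 0 < e ->
  1 <= loglog_inv e -> (2 * a1 + 1) * loglog_inv e <= log_inv e ->
  2 * b1 <= log_inv e ->
  ((expR (- (2 * a1 / b0 + 2 * b1)) / (6 * spread_cst b0) * loglog_inv e)%:E
     <= u_ext e kappa (r_ad e kappa)
     <= (expR (4 * a1 * b1 + 2 * b1) * loglog_inv e)%:E)%E.
Proof.
move=> b00 bb al q02 e0 l1 lN bN.
have [x1 xl xh] := radius_level_bounds b00 bb al l1 lN bN.
have [/andP[bb0 bb1] /andP[al0 al1]] := (bb, al).
set x := radius_level e kappa in x1 xl xh.
have x0 : 0 < x by lra.
have l0 : 0 < loglog_inv e by lra.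
have be0 : 0 < beta_of kappa by lra.
have K0 := spread_cst_gt0 b00.
have a10 : 0 < a1 by lra.
have b10 : 0 < b1 by lra.
have [m [mx xm am1 am2]] := round_radius al0 x1.
rewrite -/x -r_adE -/x// in am1 am2.
have rE : r_ad e kappa ^+ 2 = expR (- (2 * alpha_of kappa * ln x)).
  rewrite r_adE// /powR gt_eqF// -expRM_natl; congr expR; rewrite -/x; ring.
have r0 : 0 < r_ad e kappa by rewrite r_adE// powR_gt0.
have xE : 2 * beta_of kappa * x = 2 * log_inv e -
    2 * alpha_of kappa * loglog_inv e - logloglog_inv e by exact: radius_levelE.
have eE : e = expR (- log_inv e) by rewrite /log_inv lnV ?posrE// opprK lnK.
have lE : loglog_inv e = expR (logloglog_inv e) by rewrite lnK.
have lesE j : loglog_inv e * (e * sigma_seq kappa j) ^+ 2 =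
    expR (logloglog_inv e + 2 * (- log_inv e + beta_of kappa * j.+1%:R)).
  by rewrite expRD -lE [in RHS]expRM_natl expRD -eE.
have s0 := sigma_seq_gt0 kappa m.
have bm : beta_of kappa * m.+1%:R <= beta_of kappa * x by rewrite ler_pM2l.
have bm' : beta_of kappa * x <= beta_of kappa * (m.+1%:R + 1) by rewrite
  ler_pM2l.
have alx1 : alpha_of kappa * (loglog_inv e - ln x) <= a1 * (2 * b1).
  apply: (@le_trans _ _ (alpha_of kappa * (2 * b1))).
    by rewrite ler_pM2l//; lra.
  by rewrite ler_pM2r// mulr_gt0.
have alx2 : alpha_of kappa * (ln x - loglog_inv e) <= a1 * b0^-1.
  apply: (@le_trans _ _ (alpha_of kappa * b0^-1)).
    by rewrite ler_pM2l//; lra.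
  by rewrite ler_pM2r// invr_gt0.
apply/andP; split.
- rewrite (_ : _ * loglog_inv e = (expR (- (2 * a1 / b0 + 2 * b1)) / (2 *
  spread_cst b0) * loglog_inv e) / 3); last first.
    by field; rewrite gt_eqF.
  apply: u_ext_ge => //.
    apply: mulr_gt0 => //; apply: divr_gt0; [exact: expR_gt0|exact: mulr_gt0].
  move=> eta Teta; set h := _ * e ^+ 2.
  have [//|H] := pselect (exists k, h <= eta k ^+ 2); exfalso.
  have Hk k : (k <= m.+1)%N -> eta k ^+ 2 <= h.
    by move=> _; rewrite leNgt; apply/negP => /ltW lt; apply: H; exists k.
  have := @ellipsoid_head _ kappa eta b0 h (r_ad e kappa) m.+1 al0 b00 bb0 q02
    r0 am2 Teta Hk.
  apply/negP; rewrite -ltNge rE.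
  rewrite (_ : h * _ * _ = expR (- (2 * a1 / b0 + 2 * b1)) / 2 * (loglog_inv e
    * (e * sigma_seq kappa m.+1) ^+ 2)); last first.
    by rewrite /h; field; rewrite gt_eqF.
  rewrite lesE mulrAC -expRD ltr_pdivrMr//.
  apply: (@le_lt_trans _ _ (expR (- (2 * alpha_of kappa * ln x)))).
    rewrite ler_expR -[m.+2%:R]natr1; lra.
  by rewrite ltr_pMr ?expR_gt0// ltr1n.
- have q0 : 0 < q_of kappa by case/andP: q02.
  apply: le_trans (u_ext_le_radius q0 e0 r0 am1) _.
  rewrite lee_fin expr_div_n ler_pdivrMr ?exprn_gt0// ler_pdivrMr ?exprn_gt0//.
  rewrite rE [leRHS](_ : _ = expR (4 * a1 * b1 + 2 * b1) * (loglog_inv e * (e *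
    sigma_seq kappa m) ^+ 2)); last by ring.
  rewrite lesE -expRD ler_expR; lra.
Qed.

(** The ratio is [exp (alpha t)] with [t = ln (log (1/e) / (beta x))], and [beta x] differs from
    [log (1/e)] by [O(l)] uniformly over [Sigma]. *)
Lemma r_ad_equiv Sigma : compact Sigma ->
  (forall kappa, Sigma kappa ->
     [/\ 0 < alpha_of kappa, 0 < beta_of kappa & 0 < q_of kappa <= 2]) ->
  equiv_on Sigma (@r_ad R)
    (fun e kappa => (beta_of kappa / log_inv e) `^ alpha_of kappa).
Proof.
move=> cS Spos; have [b0 [b1 [a1 [b00 b01 a10 Sb]]]] := compact_param_bounds cS
  Spos.
move=> dl dl0.
have ldl : 0 < ln (1 + dl) by rewrite ln_gt0// ltrDl.
have a20 : 0 < 2 * a1 + 1 by rewrite addr_gt0// mulr_gt0.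
near=> e => kappa Sk.
have [al0 be0 q02] := Spos _ Sk; have [bb al1] := Sb _ Sk.
have l1 : 1 <= loglog_inv e by near: e; exact: loglog_inv_ge.
have N1 : 1 <= log_inv e by near: e; exact: log_inv_ge.
have bN : 2 * b1 <= log_inv e by near: e; exact: log_inv_ge.
have lN : loglog_inv e <= (2 * a1 + 1)^-1 * log_inv e.
  by near: e; apply: loglog_inv_le; rewrite invr_gt0.
have lN2 : loglog_inv e <= ln (1 + dl) / (2 * a1 * (2 * a1 + 1)) * log_inv e.
  by near: e; apply: loglog_inv_le; rewrite divr_gt0// !mulr_gt0.
rewrite ler_pdivlMl// in lN.
have al : 0 < alpha_of kappa <= a1 by rewrite al0.
have [x1 _ _] := radius_level_bounds b00 bb al l1 lN bN.
have x0 : 0 < radius_level e kappa by lra.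
have := radius_levelE e be0.
rewrite r_adE//; move: (radius_level e kappa) x1 x0 => x x1 x0 xE.
have N0 : 0 < log_inv e by lra.
have l0 : 0 < loglog_inv e by lra.
have ll0 : 0 <= logloglog_inv e by rewrite ln_ge0.
have ll1 : logloglog_inv e <= loglog_inv e by have := ln_le_sub1 l0;
  rewrite /logloglog_inv; lra.
have al2 : alpha_of kappa * loglog_inv e <= a1 * loglog_inv e by rewrite
  ler_pM2r.
have al' : 0 <= alpha_of kappa * loglog_inv e by rewrite mulr_ge0 ?ltW.
pose t := ln (log_inv e) - ln (beta_of kappa) - ln x.
have -> : x `^ (- alpha_of kappa) / (beta_of kappa / log_inv e) `^ alpha_of
  kappa
    = expR (alpha_of kappa * t).
  rewrite -powRN /powR !gt_eqF ?divr_gt0// -expRD; congr expR.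
  by rewrite lnM ?posrE ?invr_gt0// lnV ?posrE// /t; ring.
have tE : t = ln (log_inv e / (beta_of kappa * x)).
  by rewrite lnM ?posrE ?invr_gt0 ?mulr_gt0// lnV ?posrE ?mulr_gt0// lnM
    ?posrE// /t; ring.
have bx0 : 0 < beta_of kappa * x by rewrite mulr_gt0.
have t0 : 0 <= t.
  by rewrite tE ln_ge0// ler_pdivlMr// mul1r; lra.
(* With [y = (2 a1 + 1) l <= N] and [beta x >= N - y / 2 >= N / 2], [N / (beta x) - 1] is at most
   [y / N]. *)
have t1 : t <= (2 * a1 + 1) * loglog_inv e / log_inv e.
  rewrite tE; apply: le_trans (ln_le_sub1 _) _; first by rewrite divr_gt0.
  rewrite lerBlDr ler_pdivrMr//.
  rewrite (_ : _ / _ + 1 = ((2 * a1 + 1) * loglog_inv e + log_inv e) / log_inv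
    e); last first.
    by field; rewrite gt_eqF.
  rewrite mulrAC ler_pdivlMr//.
  have y0 : 0 <= (2 * a1 + 1) * loglog_inv e by rewrite mulr_ge0 ?ltW.
  have : 0 <= ((2 * a1 + 1) * loglog_inv e + log_inv e) *
      (beta_of kappa * x - (log_inv e - (2 * a1 + 1) * loglog_inv e / 2)).
    by rewrite mulr_ge0//; lra.
  move: lN y0 N0; set y := (2 * a1 + 1) * loglog_inv e.
  by move: (log_inv e) (beta_of kappa * x) y => N z y; nra.
have at0 : 0 <= alpha_of kappa * t by rewrite mulr_ge0// ltW.
rewrite ger0_norm; last by rewrite subr_ge0 -expR0 ler_expR.
rewrite ltrBlDl -[ltRHS]lnK ?posrE; last by lra.
rewrite ltr_expR.
have h : alpha_of kappa * t <= a1 * ((2 * a1 + 1) * loglog_inv e / log_inv e).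
  by rewrite ler_pM ?(ltW al0).
apply: le_lt_trans h _; rewrite !mulrA ltr_pdivrMr//.
have c0 : 0 < 2 * a1 * (2 * a1 + 1) by rewrite !mulr_gt0.
move: lN2; rewrite mulrAC ler_pdivlMr//.
have : 0 < ln (1 + dl) * log_inv e by rewrite mulr_gt0.
lra.
Unshelve. all: by end_near. Qed.

End separation_rates.

(** * Adaptive distinguishability *)

Section adaptive_rates.
Context {R : realType} {d : measure_display} {Omega : measurableType d}
  {P : probability Omega R}.
Variables (xi : nat -> {RV P >-> R}) (hxi : iid_std_normal xi).
Implicit Types Sigma : set (R * R * R).

(** Distinguishability involves no cutoff, so a concrete one must be supplied to the threshold
    test. *)
Lemma admissible_cutoff_sqrt :
  admissible_cutoff (fun e : R => (Num.truncn (Num.sqrt (loglog_inv e)))%:Z).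
Proof.
have tr (x : R) : 0 <= x -> x - 1 <= (Num.truncn x)%:R <= x.
  by move=> /truncn_itv/andP[h1 h2]; rewrite h1 andbT -natr1 in h2 *; lra.
split.
- apply/cvgryPge => x; near=> e.
  have lx : (`|x| + 1) ^+ 2 <= loglog_inv e by near: e; exact: loglog_inv_ge.
  rewrite -pmulrn; have /andP[h _] := tr _ (sqrtr_ge0 (loglog_inv e)).
  apply: le_trans h; have := ler_norm x.
  have : `|x| + 1 <= Num.sqrt (loglog_inv e).
    rewrite -[leLHS]ger0_norm ?addr_ge0// -sqrtr_sqr ler_wsqrtr//.
  lra.
- apply/cvgrPdist_le => dl dl0; near=> e.
  have l1 : 1 <= loglog_inv e by near: e; exact: loglog_inv_ge.
  have l2 : dl^-1 ^+ 2 <= loglog_inv e by near: e; exact: loglog_inv_ge.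
  have l0 : 0 < loglog_inv e by lra.
  have s0 : 0 < Num.sqrt (loglog_inv e) by rewrite sqrtr_gt0.
  rewrite -pmulrn sub0r normrN ger0_norm ?divr_ge0 ?(ltW l0)//.
  have /andP[_ h] := tr _ (sqrtr_ge0 (loglog_inv e)).
  rewrite ler_pdivrMr//; apply: (le_trans h).
  rewrite -[X in dl * X](sqr_sqrtr (ltW l0)) expr2 mulrA ler_peMl ?(ltW s0)//.
  rewrite mulrC -ler_pdivrMr// div1r.
  by rewrite -[leLHS]ger0_norm ?invr_ge0 ?(ltW dl0)// -sqrtr_sqr ler_wsqrtr.
Unshelve. all: by end_near. Qed.

Lemma loglog_inv_characterizes Sigma : compact Sigma ->
  (forall kappa, Sigma kappa ->
     [/\ 0 < alpha_of kappa, 0 < beta_of kappa & 0 < q_of kappa <= 2]) ->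
  contains_beta_interval Sigma ->
  characterizes_adaptive_distinguishability xi Sigma (@loglog_inv R).
Proof.
move=> cS Spos HS; split.
  by apply/cvgryPge => x; exact: loglog_inv_ge.
have [d0 [d00 Hlow]] := lower_bound hxi Spos HS.
have C2 : 2 < 3 :> R by rewrite ltr_nat.
have [D0 [D00 Hup]] := beta_err_threshold_cvg hxi C2 cS Spos.
(* The maximum secures the required order of the two constants. *)
exists d0, (Num.max d0 D0); split => //; first by rewrite le_max lexx.
move=> r rr; split=> [/ltW|Hr]; first exact: Hlow.
have {}Hr : (D0%:E < liminf_ratio Sigma r (@loglog_inv R))%E.
  by apply: le_lt_trans Hr; rewrite lee_fin le_max lexx orbT.
pose L (e : R) : int := (Num.truncn (Num.sqrt (loglog_inv e)))%:Z.
have HL : admissible_cutoff L by exact: admissible_cutoff_sqrt.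
apply: (@squeeze_cvgr _ _ _ _ (fun=> 0) (fun e =>
  alpha_err xi e (threshold_test 3 (L e) e) +
    beta_err xi e (Theta_union Sigma (r e)) (threshold_test 3 (L e) e))).
- near=> e; rewrite gamma_err_ge0/=; apply: gamma_err_le.
  exact: threshold_is_test.
- exact: cvg_cst.
- rewrite -[X in _ --> X]addr0; apply: cvgD; first exact:
  alpha_err_threshold_cvg.
  exact: Hup.
Unshelve. all: by end_near. Qed.

Lemma r_ad_asymp Sigma : compact Sigma ->
  (forall kappa, Sigma kappa ->
     [/\ 0 < alpha_of kappa, 0 < beta_of kappa & 0 < q_of kappa <= 2]) ->
  asymp_on Sigma (@loglog_inv R)
    (fun e kappa => u_ext e kappa (r_ad e kappa)).
Proof.
move=> cS Spos; have [b0 [b1 [a1 [b00 b01 a10 Sb]]]] := compact_param_bounds cS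
  Spos.
exists (expR (- (2 * a1 / b0 + 2 * b1)) / (6 * spread_cst b0)),
  (expR (4 * a1 * b1 + 2 * b1)); split.
- by apply: divr_gt0; [exact: expR_gt0|rewrite mulr_gt0// spread_cst_gt0].
- exact: expR_gt0.
- near=> e => kappa Sk; have [al0 _ q02] := Spos _ Sk; have [bb al1] := Sb _ Sk.
  apply: u_ext_r_ad_bounds => //.
  + by rewrite al0.
  + by near: e; exact: loglog_inv_ge.
  + rewrite -ler_pdivlMl; last by rewrite addr_gt0// mulr_gt0.
    by near: e; apply: loglog_inv_le; rewrite invr_gt0 addr_gt0// mulr_gt0.
  + by near: e; exact: log_inv_ge.
Unshelve. all: by end_near. Qed.

End adaptive_rates.

Theorem theorem5p3 (R : realType) (d : measure_display)
    (Omega : measurableType d) (P : probability Omega R)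
    (xi : nat -> {RV P >-> R}) (hxi : iid_std_normal xi)
    (Sigma : set (R * R * R)) (Sigma_compact : compact Sigma)
    (Sigma_sub : forall kappa, Sigma kappa ->
       [/\ 0 < alpha_of kappa, 0 < beta_of kappa & 0 < q_of kappa <= 2]) :
  [/\ (* (a) lower bounds *)
      contains_beta_interval Sigma ->
      exists d0 : R, 0 < d0 /\
        forall r : R -> R * R * R -> R, radii Sigma r ->
          (limsup_ratio Sigma r (@loglog_inv R) <= d0%:E)%E ->
          gamma_err xi e (Theta_union Sigma (r e)) @[e --> 0^'+] --> (1 : R),
      (* (b) upper bounds *)
      forall C : R, 2 < C ->
        (forall L : R -> int, admissible_cutoff L ->
           alpha_err xi e (threshold_test C (L e) e) @[e --> 0^'+] --> (0 : R))
        /\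
        exists D0 : R, 0 < D0 /\
          forall (L : R -> int) (r : R -> R * R * R -> R),
            admissible_cutoff L -> radii Sigma r ->
            (D0%:E < liminf_ratio Sigma r (@loglog_inv R))%E ->
            beta_err xi e (Theta_union Sigma (r e)) (threshold_test C (L e) e)
              @[e --> 0^'+] --> (0 : R) &
      (* (c) adaptive separation rates *)
      contains_beta_interval Sigma ->
      adaptive_separation_rates xi Sigma (@loglog_inv R) (@r_ad R) /\
      equiv_on Sigma (@r_ad R)
        (fun e kappa => (beta_of kappa / log_inv e) `^ alpha_of kappa)].
Proof.
split.
- exact: (lower_bound hxi).
- move=> C C2; split; first by move=> L; exact: (alpha_err_threshold_cvg hxi).
  exact: (beta_err_threshold_cvg hxi).
- move=> HS; split; last exact: r_ad_equiv.
  by split; [exact: (loglog_inv_characterizes hxi)|exact: r_ad_asymp].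
Qed.
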